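(* Consider the multi-rate system with $N$ links. Suppose the arrival vector $\boldsymbol{A}(t)=(A_1(t),\ldots,A_N(t))$ is i.i.d. over slots with $\mathbb{E}\{\boldsymbol{A}(t)\}=\boldsymbol{\lambda}$, and the channel state vector $\boldsymbol{S}(t)=(S_1(t),\ldots,S_N(t))$ is also i.i.d. over slots (entries of either vector may be correlated across links on the same slot). Suppose $\boldsymbol{\lambda}\in\rho\Lambda$ for some $\rho$ with $0<\rho<1$. Then the system is stable under the max-weight algorithm and has average delay satisfying $$\overline{W}\le\frac{N\left[\frac{1}{2\lambda_{tot}}\sum_{i=1}^N\mathbb{E}\{A_i^2\}-\frac{3}{2\lambda_{tot}}\sum_{i=1}^N\lambda_i^2\right]}{(1-\rho)\mu_{sym}}+\frac{N\min\left[\sum_{i=1}^N\frac{\lambda_i\mu_{i,max}}{\lambda_{tot}},\ \frac{\hat S^2}{\lambda_{tot}}\right]}{(1-\rho)\mu_{sym}},$$ where $\hat S^2=\mathbb{E}\{\max_{i\in\{1,\ldots,N\}}S_i(t)^2\}$ and $\mu_{sym}$ is the largest value such that $(\mu_{sym}/N,\mu_{sym}/N,\ldots,\mu_{sym}/N)\in\Lambda$. Further, in the case when all processes $S_i(t)$ are independent (across $i$) and satisfy $\Pr[S_i(t)=\mu_{i,max}]>0$, $$\mu_{sym}\ge\hat\mu\left(1-(1-p_{min})^N\right),$$ where $\hat\mu=\min_{i\in\{1,\ldots,N\}}\mu_{i,max}$ and $p_{min}=\min_{i\in\{1,\ldots,N\}}\Pr[S_i(t)\ge\hat\mu]$.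
   Context: Multi-rate system: there are $N$ links (queues) and slotted time $t\in\{0,1,2,\ldots\}$. $A_i(t)$ is the (non-negative integer) number of packets arriving to queue $i$ on slot $t$, with $\mathbb{E}\{A_i(t)^2\}<\infty$ (written $\mathbb{E}\{A_i^2\}$). The channel state $S_i(t)\in\{0,1,\ldots,\mu_{i,max}\}$ is the transmission rate available on link $i$ on slot $t$, where $\mu_{i,max}>0$ is a finite integer. Arrivals are independent of channel states. Each slot at most one link is selected; $\mu_i(t)=S_i(t)$ if link $i$ is selected and $\mu_i(t)=0$ otherwise; $\boldsymbol\mu(t)=(\mu_1(t),\ldots,\mu_N(t))$. Queue backlogs evolve as $Q_i(t+1)=\max[Q_i(t)-\mu_i(t),0]+A_i(t)$. The initial backlogs are non-negative integers with finite second moment, independent of arrival and channel processes. Max-weight algorithm: each slot, select a link with the largest value of $Q_i(t)S_i(t)$, ties broken arbitrarily. Capacity region $\Lambda$: the set of all non-negative vectors $(x_1,\ldots,x_N)$ for which there is a stationary, randomized, queue-independent policy that chooses a feasible $\boldsymbol{\mu}(t)$ as a (potentially random) function of only the current $\boldsymbol{S}(t)$, with $\mathbb{E}\{\mu_i(t)\}=x_i$ for all $i$. $\rho\Lambda=\{\rho x:x\in\Lambda\}$. $\lambda_{tot}=\sum_{i=1}^N\lambda_i>0$, and $\mu_{sym}>0$ for the delay bound. Stable means $\limsup_{t\to\infty}\frac1t\sum_{\tau=0}^{t-1}\mathbb{E}\{Q_i(\tau)\}<\infty$ for all $i$. The average delay is, by Little's Theorem, $\overline{W}=\frac{1}{\lambda_{tot}}\sum_{i=1}^N\overline{Q}_i$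 with $\overline{Q}_i=\lim_{t\to\infty}\frac1t\sum_{\tau=0}^{t-1}\mathbb{E}\{Q_i(\tau)\}$ (time averages are taken to be well defined). *)

(* Defs.v *)
From HB Require Import structures.
From mathcomp Require Import all_boot all_order all_algebra.
From mathcomp Require Import all_classical all_reals all_analysis.
Set Implicit Arguments.
Unset Strict Implicit.
Unset Printing Implicit Defensive.
Import Order.TTheory GRing.Theory Num.Theory.
Import numFieldNormedType.Exports.
Local Open Scope classical_set_scope.
Local Open Scope ring_scope.

Section Independence.
Context d (Omega : measurableType d) (R : realType) (P : probability Omega R).
Local Open Scope ereal_scope.

Definition independent (F G : set (set Omega)) : Prop :=
  forall B C, F B -> G C -> P (B `&` C) = P B * P C.

Definition mutually_independent (I : choiceType)
    (F : I -> set (set Omega)) : Prop :=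
  forall (J : seq I) (E : I -> set Omega), uniq J ->
    (forall i, i \in J -> F i (E i)) ->
    P (\bigcap_(i in [set` J]) E i) = \prod_(i <- J) P (E i).

Definition iid d' (T' : measurableType d')
    (X : nat -> {RV P >-> T'}) : Prop :=
  mutually_independent (fun t => g_sigma_algebra_preimage (X t)) /\
  forall t B, measurable B -> distribution P (X t) B = distribution P (X 0%N) B.

End Independence.

Definition process_sigma d (Omega : measurableType d) d'
    (T' : measurableType d') (X : nat -> Omega -> T') : set (set Omega) :=
  <<s \bigcup_t g_sigma_algebra_preimage (X t) >>.

Definition is_largest (R : realType) (D : set R) (m : R) : Prop :=
  D m /\ forall x, D x -> x <= m.

(* Per-link quantities on one slot are vectors in N.-tuple nat. A scheduling
   decision is an [option 'I_N]: [Some i] selects link i, [None] idles. *)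

Definition served (N : nat) (s : N.-tuple nat) (o : option 'I_N) (i : 'I_N) :
    nat :=
  if o == Some i then tnth s i else 0%N.

Definition max_weight_choice (N : nat) (q s : N.-tuple nat)
    (o : option 'I_N) : Prop :=
  exists2 i, o = Some i &
    forall j, (tnth q j * tnth s j <= tnth q i * tnth s i)%N.

(* Truncated subtraction on nat is max[q - mu, 0]. *)
Definition backlog_step (N : nat) (q s a : N.-tuple nat) (o : option 'I_N) :
    N.-tuple nat :=
  [tuple (tnth q i - served s o i + tnth a i)%N | i < N].

Section MultiRate.
Context d (Omega : measurableType d) (R : realType) (P : probability Omega R).
Variable N : nat.

(* The information available when the link of slot t is selected: the initial
   backlogs, a seed U for randomized choices, the arrivals of the slots before t
   and the channel states of the slots up to and including t. *)
Definition information d' (T' : measurableType d')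
    (Q0 : {RV P >-> N.-tuple nat}) (U : {RV P >-> T'})
    (A S : nat -> {RV P >-> N.-tuple nat}) (t : nat) : set (set Omega) :=
  <<s g_sigma_algebra_preimage Q0 `|` g_sigma_algebra_preimage U `|`
      (\bigcup_(tau in [set k | (k < t)%N]) g_sigma_algebra_preimage (A tau)) `|`
      (\bigcup_(tau in [set k | (k <= t)%N]) g_sigma_algebra_preimage (S tau)) >>.

Definition nonanticipating d' (T' : measurableType d')
    (Q0 : {RV P >-> N.-tuple nat}) (U : {RV P >-> T'})
    (A S : nat -> {RV P >-> N.-tuple nat})
    (sel : nat -> Omega -> option 'I_N) : Prop :=
  forall t o, information Q0 U A S t [set w | sel t w = o].

(* A stationary, randomized, queue-independent policy: [policy s] is the
   probability distribution of the decision taken in channel state s. *)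
Definition randomized_policy (policy : N.-tuple nat -> option 'I_N -> R) :
    Prop :=
  forall s, (forall o, 0 <= policy s o) /\ \sum_o policy s o = 1.

Definition policy_rate (S : {RV P >-> N.-tuple nat})
    (policy : N.-tuple nat -> option 'I_N -> R) (i : 'I_N) : \bar R :=
  ('E_P[fun w => (\sum_o policy (S w) o * (served (S w) o i)%:R)%R])%E.

(* S has the common distribution of the channel states of all slots. *)
Definition capacity_region (S : {RV P >-> N.-tuple nat}) : set 'rV[R]_N :=
  [set x | (forall i, 0 <= x 0 i) /\
    exists2 policy, randomized_policy policy &
      forall i, policy_rate S policy i = (x 0 i)%:E].

Definition symmetric_rates (S : {RV P >-> N.-tuple nat}) : set R :=
  [set m | capacity_region S (const_mx (m / N%:R))].

Definition time_average (Q : nat -> {RV P >-> N.-tuple nat}) (i : 'I_N)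
    (t : nat) : \bar R :=
  ((t%:R^-1)%:E * \sum_(0 <= tau < t) 'E_P[fun w => (tnth (Q tau w) i)%:R])%E.

Definition stable (Q : nat -> {RV P >-> N.-tuple nat}) : Prop :=
  forall i, (limn_esup (time_average Q i) < +oo)%E.

Definition average_delay (lambda_tot : R)
    (Q : nat -> {RV P >-> N.-tuple nat}) : \bar R :=
  ((lambda_tot^-1)%:E * \sum_(i < N) limn (time_average Q i))%E.

(* Meaningful when the expectation is finite: [fine] sends +oo to 0. *)
Definition second_moment (X : {RV P >-> N.-tuple nat}) (i : 'I_N) : R :=
  fine 'E_P[fun w => (tnth (X w) i)%:R ^+ 2].

Definition max_rate_second_moment (S : {RV P >-> N.-tuple nat}) : R :=
  fine 'E_P[fun w => ((\max_(i < N) tnth (S w) i ^ 2)%N)%:R].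

(* The initial value of the fold is the maximum, so that for N > 0 the result
   is the minimum of the family. *)
Definition min_rate (mu_max : 'I_N -> nat) : nat :=
  \big[minn/(\max_(i < N) mu_max i)%N]_(i < N) mu_max i.

(* The initial value 1 is harmless, since probabilities are at most 1. *)
Definition min_prob (S : {RV P >-> N.-tuple nat}) (m : nat) : R :=
  \big[Num.min/1]_(i < N) fine (P [set w | (m <= tnth (S w) i)%N]).

End MultiRate.

(* Main.v *)
Require Import Defs.
From HB Require Import structures.
From mathcomp Require Import all_boot all_order all_algebra.
From mathcomp Require Import all_classical all_reals all_analysis.
From mathcomp Require Import perm measurable_realfun.
From mathcomp Require Import ring lra.
Import Order.TTheory GRing.Theory Num.Theory.
Import numFieldNormedType.Exports.
Local Open Scope classical_set_scope.
Local Open Scope ring_scope.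

(** The proof is a Lyapunov drift argument.  On one slot, with departures
    [m = min(Q, mu)], the backlog of a link moves from [Q] to [Q - m + A], and
    [Q * mu = Q * m + m * (mu - m)], since service is wasted only when the queue
    empties.  Hence the square of the backlog increases by
    [- 2 Q mu + 2 Q A + 2 m mu - m^2 - 2 m A + A^2].  Bounding [m^2] from below
    by its tangent at the arrival rate [l] makes this affine in [m], and [E m]
    is [l - E (Q' - Q)]; subtracting [4 l Q] from the square ([lyapunov]) absorbs
    that increment.  Besides the terms in [Q], the expected drift is then at most
    [E A^2 - 3 l^2 + 2 E (m mu)].  The last expectation, summed over the links, is
    at most the second moment of the largest rate, as a single link is served,
    and on each link at most [mu_max * E m], which a further term linear in the
    backlog turns into [mu_max * l]; this is the minimum in the bound.

    The backlog at the start of a slot is independent of its channel state, and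
    the triple of backlog, channel state and decision is independent of the
    arrivals of the slot ([history_channel_independent],
    [history_arrival_independent], by the pi-lambda theorem).
    Max-weight maximizes [sum Q mu] pointwise, so in expectation it does at least
    as well as any vector of the capacity region ([max_weight_capacity]).  With
    [lambda = rho x], comparing with [x] for a share [rho] and with another
    vector [y] for a share [1 - rho] gives a drift of at most
    [- 2 (1 - rho) sum y E Q] plus a constant ([mean_drift]).
    Summing over the slots bounds the time averages: [y = x] yields stability,
    and [y] with all entries [mu_sym / N] yields the delay bound.

    For the lower bound on [mu_sym], call a link fast if its rate is at least
    [k], here the smallest [mu_max].  Thinning the random set of fast links makes
    all inclusion probabilities equal to the smallest one, [p]; a link drawn
    uniformly from the thinned set is then equally likely to be any of the
    [N] links, and some link is drawn with probability [1 - (1 - p)^N]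
    ([symmetric_rate_achievable]).  Such a link transmits at rate at least [k],
    and idling part of the time makes all rates equal to [k / N] times that
    probability. *)

Set Implicit Arguments.
Unset Strict Implicit.
Unset Printing Implicit Defensive.

(** * Countably valued functions and independence *)

Section CountableValued.
Context (Om : Type) (G : set (set Om)).
Hypothesis sG : sigma_algebra setT G.

(** The set system [G] determines the value of [X]: every level set of [X]
    belongs to it.  For a countable codomain and a sigma-algebra [G], this is
    measurability of [X] for the discrete sigma-algebra. *)
Definition determines (T : Type) (X : Om -> T) :=
  forall x, G [set w | X w = x].

Lemma determines_preimage (T : countType) (X : Om -> T) (B : set T) :
  determines X -> G [set w | B (X w)].
Proof.
case: sG => G0 _ GU GX.
pose F n := if pickle_inv n is Some x then
  (if `[< B x >] then [set w | X w = x] else set0) else set0.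
rewrite (_ : [set w | B (X w)] = \bigcup_n F n); last first.
  apply/seteqP; split => w /=.
    move=> BX; exists (pickle (X w)) => //.
    by rewrite /F pickleK_inv; case: asboolP.
  move=> [n _]; rewrite /F; case: (pickle_inv n) => // x.
  by case: asboolP => //= Bx ->.
apply: GU => n; rewrite /F; case: (pickle_inv n) => // x.
by case: asboolP.
Qed.

Lemma determines_comp (T : countType) (T' : Type) (X : Om -> T) (f : T -> T') :
  determines X -> determines (f \o X).
Proof. by move=> GX y; exact: (@determines_preimage _ _ [set x | f x = y]). Qed.

Lemma determines_setI A B : G A -> G B -> G (A `&` B).
Proof.
case: sG => G0 GC GU GA GB.
rewrite -(setCK (A `&` B)) setCI -setTD; apply: (GC).
rewrite -bigcup2E; apply: GU => -[|[|n]] //=; rewrite -setTD; exact: (GC).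
Qed.

Lemma determines_pair (T T' : Type) (X : Om -> T) (Y : Om -> T') :
  determines X -> determines Y -> determines (fun w => (X w, Y w)).
Proof.
move=> GX GY [x y].
rewrite (_ : [set w | _] = [set w | X w = x] `&` [set w | Y w = y]).
  exact: determines_setI.
by apply/seteqP; split => w /= [-> ->].
Qed.

End CountableValued.

Lemma measurable_tuple_nat (N : nat) (B : set (N.-tuple nat)) : measurable B.
Proof.
apply: countable_measurable; last exact: countableP.
move=> t; rewrite (_ : [set t] = \big[setI/setT]_(i < N)
   ((@tnth _ nat ^~ i) @^-1` [set tnth t i])); last first.
  apply/seteqP; split => [x ->|x].
    by apply: (big_ind (fun D : set _ => D t)) => //; move=> ? ? ? ?; split.
  by move=> H; apply: eq_from_tnth => i; move: H; rewrite (bigD1 i)//= => -[].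
elim/big_ind: _ => //; first by move=> *; exact: measurableI.
move=> i _; rewrite -[X in measurable X]setTI; exact: measurable_tnth.
Qed.

Section Independence.
Local Open Scope ereal_scope.
Context d (Om : measurableType d) (R : realType) (P : probability Om R).

(** Dynkin's pi-lambda theorem, for independence from a fixed event. *)
Lemma independent_of_pi_system (G : set (set Om)) (C : set Om) :
  setI_closed G -> G `<=` measurable -> measurable C ->
  (forall B, G B -> P (B `&` C) = P B * P C) ->
  forall B, <<s G >> B -> P (B `&` C) = P B * P C.
Proof.
move=> GI Gm mC GC.
suff H : <<s G >> `<=` [set B | measurable B /\ P (B `&` C) = P B * P C].
  by move=> B /H[].
rewrite -(setI_closed_g_dynkin_g_sigma_algebra GI).
apply: smallest_sub; last by move=> B GB; split; [exact: Gm|exact: GC].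
split.
- by split => //; rewrite setTI probability_setT mul1e.
- move=> B [mB PB]; split; first exact: measurableC.
  have PCB : P (C `\` B) = P C - P (B `&` C).
    by rewrite [B `&` C]setIC measureD// -ge0_fin_numE ?fin_num_measure.
  rewrite setIC -setDE PCB PB probability_setC// muleBl ?mul1e//.
    by rewrite fin_num_measure.
- move=> F tF FH; have mF n : measurable (F n) by case: (FH n).
  split; first exact: bigcup_measurable.
  have PF : P (\bigcup_n F n) = \sum_(n <oo) P (F n).
    by rewrite measure_semi_bigcup//; exact: bigcup_measurable.
  have PFC : P (\bigcup_n (F n `&` C)) = \sum_(n <oo) P (F n `&` C).
    rewrite measure_semi_bigcup//.
    + by move=> i; exact: measurableI.
    + apply/trivIsetP => i j _ _ ij.
      by rewrite setIACA (trivIsetP.1 tF) ?set0I.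
    + by apply: bigcup_measurable => k _; exact: measurableI.
  rewrite setI_bigcupl PFC PF.
  under eq_eseriesr do rewrite (FH _).2 muleC.
  rewrite -(@fineK _ (P C)) ?fin_num_measure//.
  by rewrite nneseriesZl// muleC.
Qed.

End Independence.

Section History.
Local Open Scope ereal_scope.
Context d (Om : measurableType d) (R : realType) (P : probability Om R).

Lemma preimage_measurable d' (T' : measurableType d') (X : {RV P >-> T'}) :
  g_sigma_algebra_preimage X `<=` measurable.
Proof. by move=> _ [B mB <-]; rewrite setTI; exact: measurable_funPTI. Qed.

Lemma preimage_sigma_algebra d' (T' : measurableType d') (X : Om -> T') :
  sigma_algebra setT (g_sigma_algebra_preimage X).
Proof. exact: sigma_algebra_preimage (@sigma_algebra_measurable _ T'). Qed.

Lemma sigma_algebraT (G : set (set Om)) : sigma_algebra setT G -> G setT.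
Proof. by case=> G0 GC _; rewrite -(setD0 setT); exact: GC. Qed.

(** The sigma-algebra generated by [X 0, ..., X n.-1]. *)
Definition past d' (T' : measurableType d') (X : nat -> {RV P >-> T'}) n :=
  <<s \bigcup_(k in [set k | (k < n)%N]) g_sigma_algebra_preimage (X k) >>.

Lemma past_measurable d' (T' : measurableType d') (X : nat -> {RV P >-> T'}) n :
  past X n `<=` measurable.
Proof.
apply: smallest_sub; first exact: sigma_algebra_measurable.
by move=> B [k _]; exact: preimage_measurable.
Qed.

Lemma past_process d' (T' : measurableType d') (X : nat -> {RV P >-> T'}) n :
  past X n `<=` process_sigma X.
Proof.
apply: sub_smallest2r; first exact: smallest_sigma_algebra.
by move=> B [k _ XB]; exists k.
Qed.

Lemma preimage_process d' (T' : measurableType d') (X : nat -> {RV P >-> T'}) n :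
  g_sigma_algebra_preimage (X n) `<=` process_sigma X.
Proof. by move=> B XB; apply: sub_sigma_algebra; exists n. Qed.

Lemma past_independent d' (T' : measurableType d') (X : nat -> {RV P >-> T'}) n :
  mutually_independent P (fun t => g_sigma_algebra_preimage (X t)) ->
  independent P (past X n) (g_sigma_algebra_preimage (X n)).
Proof.
move=> XI B C pB XC; have mC := preimage_measurable XC.
(* finite intersections of events of the single slots form a pi-system *)
pose G := [set B | exists2 F : nat -> set Om,
  (forall k, g_sigma_algebra_preimage (X k) (F k)) &
  B = \bigcap_(k in [set` iota 0 n]) F k].
have {pB}GB : <<s G >> B.
  move: pB; apply: smallest_sub; first exact: smallest_sigma_algebra.
  move=> D [k /= kn XD]; apply: sub_sigma_algebra.
  exists (fun j => if j == k then D else setT).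
    move=> j; case: eqP => [->//|_].
    exact: (sigma_algebraT (@preimage_sigma_algebra _ _ (X j))).
  apply/seteqP; split => w.
    by move=> Dw j _; case: eqP.
  by move=> /(_ k); rewrite /= mem_iota eqxx kn; exact.
apply: (independent_of_pi_system _ _ mC _ GB) => {B GB}.
- move=> _ _ [F XF ->] [F' XF' ->]; exists (fun k => F k `&` F' k).
    by move=> k; apply: determines_setI => //; exact: preimage_sigma_algebra.
  by rewrite bigcapI.
- move=> _ [F XF ->]; apply: bigcap_measurableType => k _.
  exact: preimage_measurable (XF k).
- move=> _ [F XF ->].
  pose E k := if k == n then C else F k.
  have XE k : g_sigma_algebra_preimage (X k) (E k).
    by rewrite /E; case: eqP => [->|].
  have EF k : k \in iota 0 n -> E k = F k.
    by rewrite mem_iota /E => /andP[_ /ltn_eqF ->].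
  have := XI (iota 0 n.+1) E (iota_uniq _ _) (fun k _ => XE k).
  have := XI (iota 0 n) F (iota_uniq _ _) (fun k _ => XF k).
  move=> PF; rewrite -addn1 iotaD add0n big_cat big_seq1.
  rewrite (eq_big_seq (fun k => P (F k))); last by move=> k /EF ->.
  rewrite -PF {2}/E eqxx => <-; congr (P _).
  apply/seteqP; split => w.
    move=> [Fw Cw] k; rewrite /= mem_cat inE => /orP[kn|/eqP ->].
      by rewrite EF//; exact: Fw.
    by rewrite /E eqxx.
  move=> Ew; split => [k /= kn|].
    by rewrite -EF//; apply: Ew; rewrite /= mem_cat kn.
  by have := Ew n; rewrite /E eqxx; apply; rewrite /= mem_cat inE eqxx orbT.
Qed.

End History.

Section SystemHistory.
Local Open Scope ereal_scope.
Context d (Om : measurableType d) (R : realType) (P : probability Om R) (N : nat).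
Context d' (T' : measurableType d').
Variables (Q0 : {RV P >-> N.-tuple nat}) (U : {RV P >-> T'}).
Variables (A S : nat -> {RV P >-> N.-tuple nat}).

(** What is known from the initial backlogs, the seed, the arrivals of the
    first [a] slots and the channel states of the first [s] slots.  Keeping
    [a] and [s] apart covers both the state of knowledge when slot [t] begins
    ([a = s = t]) and the one when its link is selected ([a = t],
    [s = t.+1]). *)
Definition history (a s : nat) : set (set Om) :=
  <<s g_sigma_algebra_preimage Q0 `|` g_sigma_algebra_preimage U `|`
      (\bigcup_(tau in [set k | (k < a)%N]) g_sigma_algebra_preimage (A tau)) `|`
      (\bigcup_(tau in [set k | (k < s)%N]) g_sigma_algebra_preimage (S tau)) >>.

Lemma history_sigma_algebra a s : sigma_algebra setT (history a s).
Proof. exact: smallest_sigma_algebra. Qed.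

Lemma history_sub a s a' s' : (a <= a')%N -> (s <= s')%N ->
  history a s `<=` history a' s'.
Proof.
move=> aa' ss'; apply: sub_smallest2r; first exact: smallest_sigma_algebra.
move=> B [[QU|[k /= ka AB]]|[k /= ks SB]].
- by left; left.
- by left; right; exists k => //=; exact: leq_trans aa'.
- by right; exists k => //=; exact: leq_trans ss'.
Qed.

Lemma history_init a s : g_sigma_algebra_preimage Q0 `<=` history a s.
Proof. by move=> B QB; apply: sub_sigma_algebra; left; left; left. Qed.

Lemma history_arrival a s k : (k < a)%N ->
  g_sigma_algebra_preimage (A k) `<=` history a s.
Proof.
by move=> ka B AB; apply: sub_sigma_algebra; left; right; exists k.
Qed.

Lemma history_channel a s k : (k < s)%N ->
  g_sigma_algebra_preimage (S k) `<=` history a s.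
Proof. by move=> ks B SB; apply: sub_sigma_algebra; right; exists k. Qed.

Lemma history_measurable a s : history a s `<=` measurable.
Proof.
apply: smallest_sub; first exact: sigma_algebra_measurable.
move=> B [[[|]|[k _]]|[k _]]; exact: preimage_measurable.
Qed.

Hypothesis A_S_indep : independent P (process_sigma A) (process_sigma S).
Hypothesis Q0_U_indep : independent P
  <<s g_sigma_algebra_preimage Q0 `|` g_sigma_algebra_preimage U >>
  <<s process_sigma A `|` process_sigma S >>.

Lemma arrivals_channels_indep E F G :
  <<s g_sigma_algebra_preimage Q0 `|` g_sigma_algebra_preimage U >> E ->
  process_sigma A F -> process_sigma S G ->
  P (E `&` F `&` G) = P E * P F * P G.
Proof.
move=> QE AF SG; rewrite -setIA Q0_U_indep//.
  by rewrite A_S_indep// muleA.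
apply: (@determines_setI _ <<s process_sigma A `|` process_sigma S >>).
- exact: smallest_sigma_algebra.
- by apply: sub_sigma_algebra; left.
- by apply: sub_sigma_algebra; right.
Qed.

(** The history is generated by the intersections of an event of the initial
    data, an event of the past arrivals and an event of the past channel
    states, and these form a pi-system. *)
Lemma history_independent a s C : measurable C ->
  (forall E F G,
    <<s g_sigma_algebra_preimage Q0 `|` g_sigma_algebra_preimage U >> E ->
    past A a F -> past S s G ->
    P (E `&` F `&` G `&` C) = P (E `&` F `&` G) * P C) ->
  forall B, history a s B -> P (B `&` C) = P B * P C.
Proof.
move=> mC piC B HB.
set init := <<s _ >> in piC *.
have sinit : sigma_algebra setT init by exact: smallest_sigma_algebra.
have sA : sigma_algebra setT (past A a) by exact: smallest_sigma_algebra.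
have sS : sigma_algebra setT (past S s) by exact: smallest_sigma_algebra.
pose G := [set B | exists E F G,
  [/\ init E, past A a F, past S s G & B = E `&` F `&` G]].
have {HB}GB : <<s G >> B.
  move: HB; apply: smallest_sub; first exact: smallest_sigma_algebra.
  move=> D [[QU|AD]|SD]; apply: sub_sigma_algebra.
  - exists D, setT, setT; split; rewrite ?setIT//; last 2 first.
    + exact: sigma_algebraT.
    + exact: sigma_algebraT.
    + exact: sub_sigma_algebra.
  - exists setT, D, setT; split; rewrite ?setIT ?setTI//; last 2 first.
    + exact: sub_sigma_algebra.
    + exact: sigma_algebraT.
    + exact: sigma_algebraT.
  - exists setT, setT, D; split; rewrite ?setIT ?setTI//; last 2 first.
    + exact: sigma_algebraT.
    + exact: sub_sigma_algebra.
    + exact: sigma_algebraT.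
apply: (independent_of_pi_system _ _ mC _ GB).
- move=> _ _ [E [F [H [iE AF SH ->]]]] [E' [F' [H' [iE' AF' SH' ->]]]].
  exists (E `&` E'), (F `&` F'), (H `&` H'); split; last first.
  + by rewrite (setIACA (E `&` F)) (setIACA E).
  + exact: (determines_setI sS).
  + exact: (determines_setI sA).
  + exact: (determines_setI sinit).
- move=> _ [E [F [H [iE AF SH ->]]]]; apply: measurableI.
    apply: measurableI; last exact: past_measurable AF.
    move: iE; apply: smallest_sub; first exact: sigma_algebra_measurable.
    by move=> D [|]; exact: preimage_measurable.
  exact: past_measurable SH.
- by move=> _ [E [F [H [iE AF SH ->]]]]; exact: piC.
Qed.

Lemma history_arrival_independent a s B C :
  mutually_independent P (fun t => g_sigma_algebra_preimage (A t)) ->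
  history a s B -> g_sigma_algebra_preimage (A a) C ->
  P (B `&` C) = P B * P C.
Proof.
move=> A_indep HB AC; apply: history_independent HB.
  exact: preimage_measurable AC.
move=> E F G QE AF SG.
have pF := past_process AF; have pG := past_process SG.
have pFC : process_sigma A (F `&` C).
  apply: (@determines_setI _ (process_sigma A)) => //.
    exact: smallest_sigma_algebra.
  exact: preimage_process AC.
rewrite setIAC -(setIA E) (arrivals_channels_indep QE pFC pG).
rewrite (arrivals_channels_indep QE pF pG) (past_independent A_indep AF AC).
by rewrite -!muleA (muleC (P C)).
Qed.

Lemma history_channel_independent a s B C :
  mutually_independent P (fun t => g_sigma_algebra_preimage (S t)) ->
  history a s B -> g_sigma_algebra_preimage (S s) C ->
  P (B `&` C) = P B * P C.
Proof.
move=> S_indep HB SC; apply: history_independent HB.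
  exact: preimage_measurable SC.
move=> E F G QE AF SG.
have pF := past_process AF; have pG := past_process SG.
have pGC : process_sigma S (G `&` C).
  apply: (@determines_setI _ (process_sigma S)) => //.
    exact: smallest_sigma_algebra.
  exact: preimage_process SC.
rewrite -(setIA (E `&` F)) (arrivals_channels_indep QE pF pGC).
rewrite (arrivals_channels_indep QE pF pG) (past_independent S_indep SG SC).
by rewrite muleA.
Qed.

End SystemHistory.

(** * Expectations of countably valued random variables *)

Section CountableIntegral.
Local Open Scope ereal_scope.
Context d (Om : measurableType d) (R : realType) (P : probability Om R).

Lemma determines_measurable_fun (T : countType) d' (T' : measurableType d')
  (X : Om -> T) (g : T -> T') :
  determines measurable X -> measurable_fun setT (g \o X).
Proof.
move=> mX _ B mB; rewrite setTI.
apply: (@determines_preimage _ _ (@sigma_algebra_measurable _ Om) _ X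
  [set x | B (g x)]) mX.
Qed.

(** Integrals split along the level sets of a variable with values in [nat]. *)
Lemma integral_nat_valued (X : Om -> nat) (D : set Om) (f : Om -> \bar R) :
  measurable D -> determines measurable X -> measurable_fun setT f ->
  (forall w, 0 <= f w) ->
  \int[P]_(w in D) f w =
    \sum_(n <oo) \int[P]_(w in D `&` [set w | X w = n]) f w.
Proof.
move=> mD mX mf f0.
have {1}-> : D = \bigcup_n (D `&` [set w | X w = n]).
  by apply/seteqP; split => [w Dw|w [n _ []]//]; exists (X w).
rewrite ge0_integral_bigcup//.
- by move=> n; exact: measurableI.
- exact: measurable_funTS.
- apply/trivIsetP => i j _ _ /eqP ij; apply/seteqP; split => // w.
  by move=> [[_ /= Xi] [_ /= Xj]]; apply: ij; rewrite -Xi -Xj.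
Qed.

Lemma integral_mul_nat_valued (X Y : Om -> nat) (f g : nat -> R) :
  determines measurable X -> determines measurable Y ->
  (forall n, 0 <= f n)%R -> (forall n, 0 <= g n)%R ->
  (forall m n, P ([set w | X w = m] `&` [set w | Y w = n]) =
     P [set w | X w = m] * P [set w | Y w = n]) ->
  P.-integrable setT (fun w => (f (X w))%:E) ->
  \int[P]_w (f (X w) * g (Y w))%:E =
  \int[P]_w (f (X w))%:E * \int[P]_w (g (Y w))%:E.
Proof.
move=> mX mY f0 g0 XY intf.
have mf : measurable_fun setT (fun w => (f (X w))%:E).
  exact: (determines_measurable_fun (fun n => (f n)%:E) mX).
have mg : measurable_fun setT (fun w => (g (Y w))%:E).
  exact: (determines_measurable_fun (fun n => (g n)%:E) mY).
have mfg : measurable_fun setT (fun w => (f (X w) * g (Y w))%:E).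
  by under eq_fun do rewrite EFinM; exact: emeasurable_funM.
have If n : \int[P]_(w in [set w | Y w = n]) (f (X w))%:E =
    P [set w | Y w = n] * \int[P]_w (f (X w))%:E.
  have mYn : measurable [set w | Y w = n] by exact: mY.
  rewrite -(@fineK _ (P [set w | Y w = n])); last exact: fin_num_measure.
  rewrite (integral_nat_valued mYn mX)//; last by move=> w; rewrite lee_fin.
  rewrite [X in _ = _ * X](integral_nat_valued measurableT mX)//; last first.
    by move=> w; rewrite lee_fin.
  rewrite -nneseriesZl; last first.
    by move=> m _; apply: integral_ge0 => w _; rewrite lee_fin.
  apply: eq_eseriesr => m _.
  have cf D : measurable D ->
      \int[P]_(w in D `&` [set w | X w = m]) (f (X w))%:E =
      (f m)%:E * P ([set w | X w = m] `&` D).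
    move=> mD; rewrite setIC -integral_cst; last exact: measurableI.
    by apply: eq_integral => w; rewrite inE => -[/= -> _].
  rewrite cf// cf// setIT XY fineK; last exact: fin_num_measure.
  by rewrite muleA muleC.
rewrite (integral_nat_valued measurableT mY)//; last first.
  by move=> w; rewrite lee_fin mulr_ge0.
rewrite [X in _ = _ * X](integral_nat_valued measurableT mY)//; last first.
  by move=> w; rewrite lee_fin.
have If_fin := integrable_fin_num measurableT intf.
rewrite -(fineK If_fin) -nneseriesZl; last first.
  by move=> n _; apply: integral_ge0 => w _; rewrite lee_fin.
apply: eq_eseriesr => n _; rewrite !setTI (fineK If_fin).
have mYn : measurable [set w | Y w = n] by exact: mY.
rewrite [LHS](eq_integral (fun w => (g n)%:E * (f (X w))%:E)); last first.
  by move=> w; rewrite inE => /= ->; rewrite mulrC EFinM.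
rewrite ge0_integralZl_EFin//; last 2 first.
  by move=> w _; rewrite lee_fin.
  exact: measurable_funTS.
rewrite [X in _ = _ * X](eq_integral (fun _ => (g n)%:E)); last first.
  by move=> w; rewrite inE => /= ->.
by rewrite integral_cst// If muleA muleC.
Qed.

End CountableIntegral.

Section Mean.
Context d (Om : measurableType d) (R : realType) (P : probability Om R).

(** Real-valued expectation; meaningful for an integrable function. *)
Definition mean (f : Om -> R) : R := \int[P]_w f w.

(** [f] is measurable and its absolute value has a finite expectation. *)
Definition integrable_rv (f : Om -> R) := P.-integrable setT (EFin \o f).

Lemma expectation_mean f : integrable_rv f -> ('E_P[f] = (mean f)%:E)%E.
Proof.
move=> intf; rewrite unlock /mean /Rintegral fineK//.
exact: integrable_fin_num intf.
Qed.

Lemma mean_expectation f (x : R) : ('E_P[f] = x%:E)%E -> mean f = x.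
Proof. by rewrite unlock /mean /Rintegral => ->. Qed.

Lemma integrable_rv_cst r : integrable_rv (cst r).
Proof. exact: finite_measure_integrable_cst. Qed.

Lemma integrable_rvD f g : integrable_rv f -> integrable_rv g ->
  integrable_rv (fun w => f w + g w).
Proof. by move=> intf intg; exact: (integrableD measurableT intf intg). Qed.

Lemma integrable_rvB f g : integrable_rv f -> integrable_rv g ->
  integrable_rv (fun w => f w - g w).
Proof. by move=> intf intg; exact: (integrableB measurableT intf intg). Qed.

Lemma integrable_rvZ k f : integrable_rv f -> integrable_rv (fun w => k * f w).
Proof. by move=> intf; exact: (integrableZl measurableT k intf). Qed.

Lemma integrable_rv_sum (I : Type) (s : seq I) (f : I -> Om -> R) :
  (forall i, integrable_rv (f i)) ->
  integrable_rv (fun w => \sum_(i <- s) f i w).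
Proof.
move=> intf; rewrite /integrable_rv.
rewrite (_ : EFin \o _ = fun w => (\sum_(i <- s) (f i w)%:E)%E).
  by apply: integrable_sum => // i _; exact: intf.
by apply/funext => w /=; rewrite sumEFin.
Qed.

Lemma le_integrable_rv (f g : Om -> R) : measurable_fun setT f ->
  (forall w, `|f w| <= g w) -> integrable_rv g -> integrable_rv f.
Proof.
move=> mf fg; apply: le_integrable => //; first exact/measurable_EFinP.
by move=> w _ /=; rewrite lee_fin (le_trans (fg w))// ler_norm.
Qed.

Lemma meanD f g : integrable_rv f -> integrable_rv g ->
  mean (fun w => f w + g w) = mean f + mean g.
Proof. by move=> intf intg; rewrite /mean RintegralD. Qed.

Lemma meanB f g : integrable_rv f -> integrable_rv g ->
  mean (fun w => f w - g w) = mean f - mean g.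
Proof. by move=> intf intg; rewrite /mean RintegralB. Qed.

Lemma meanZ k f : integrable_rv f -> mean (fun w => k * f w) = k * mean f.
Proof. by move=> intf; rewrite /mean RintegralZl. Qed.

Lemma mean_cst r : mean (cst r) = r.
Proof. by rewrite /mean Rintegral_cst//= probability_setT mulr1. Qed.

Lemma mean_sum (I : Type) (s : seq I) (f : I -> Om -> R) :
  (forall i, integrable_rv (f i)) ->
  mean (fun w => \sum_(i <- s) f i w) = \sum_(i <- s) mean (f i).
Proof.
move=> intf; elim: s => [|i s IH].
  rewrite big_nil -[RHS](mean_cst 0); congr mean.
  by apply/funext => w; rewrite big_nil.
rewrite big_cons -IH -meanD//; last exact: integrable_rv_sum.
by congr mean; apply/funext => w; rewrite big_cons.
Qed.

Lemma le_mean f g : integrable_rv f -> integrable_rv g ->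
  (forall w, f w <= g w) -> mean f <= mean g.
Proof. by move=> intf intg fg; rewrite /mean le_Rintegral. Qed.

Lemma mean_ge0 (f : Om -> R) : (forall w, 0 <= f w) -> 0 <= mean f.
Proof. by move=> f0; exact: Rintegral_ge0. Qed.

(** A product rule for point events suffices for the product rule of
    expectations, since the variables have countably many values. *)
Lemma mean_mul_independent (T1 T2 : countType) (X : Om -> T1) (Y : Om -> T2)
    (f : T1 -> R) (g : T2 -> R) :
  determines measurable X -> determines measurable Y ->
  (forall x, 0 <= f x) -> (forall y, 0 <= g y) ->
  (forall x y, P ([set w | X w = x] `&` [set w | Y w = y]) =
     P [set w | X w = x] * P [set w | Y w = y])%E ->
  integrable_rv (f \o X) -> integrable_rv (g \o Y) ->
  integrable_rv (fun w => f (X w) * g (Y w)) /\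
  mean (fun w => f (X w) * g (Y w)) = mean (f \o X) * mean (g \o Y).
Proof.
move=> mX mY f0 g0 XY intf intg.
pose f' n := oapp f 0 (pickle_inv n); pose g' n := oapp g 0 (pickle_inv n).
pose X' := pickle \o X; pose Y' := pickle \o Y.
have fX w : f' (X' w) = f (X w) by rewrite /f' /X' /= pickleK_inv.
have gY w : g' (Y' w) = g (Y w) by rewrite /g' /Y' /= pickleK_inv.
have levelE (T : countType) (Z : Om -> T) m :
    [set w | (pickle \o Z) w = m] =
    if pickle_inv m is Some x then [set w | Z w = x] else set0.
  have := @pickle_invK T m; case E : (pickle_inv m) => [x|] /= mE.
    apply/seteqP; split => w /=; rewrite -mE; last by move=> ->.
    exact: (pcan_inj pickleK_inv).
  by apply/seteqP; split => // w /= Zw; move: E; rewrite -Zw pickleK_inv.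
have E : (\int[P]_w (f (X w) * g (Y w))%:E =
    \int[P]_w (f (X w))%:E * \int[P]_w (g (Y w))%:E)%E.
  have sM := @sigma_algebra_measurable _ Om.
  under eq_integral do rewrite -fX -gY.
  under [X in (_ = X * _)%E]eq_integral do rewrite -fX.
  under [X in (_ = _ * X)%E]eq_integral do rewrite -gY.
  apply: integral_mul_nat_valued.
  - exact: (determines_comp sM).
  - exact: (determines_comp sM).
  - by move=> n; rewrite /f'; case: (pickle_inv n).
  - by move=> n; rewrite /g'; case: (pickle_inv n).
  - move=> m n; rewrite !levelE.
    case: (pickle_inv m) => [x|]; last by rewrite set0I measure0 mul0e.
    case: (pickle_inv n) => [y|]; last by rewrite setI0 measure0 mule0.
    exact: XY.
  - by under eq_fun do rewrite fX.
have If := integrable_fin_num measurableT intf.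
have Ig := integrable_fin_num measurableT intg.
split; last by rewrite /mean /Rintegral E fineM.
apply/integrableP; split.
  apply/measurable_EFinP/measurable_funM; apply/measurable_EFinP.
    exact: measurable_int intf.
  exact: measurable_int intg.
under eq_integral do rewrite gee0_abs ?lee_fin ?mulr_ge0//.
by rewrite E -ge0_fin_numE ?fin_numM// mule_ge0// integral_ge0// => w _;
  rewrite lee_fin.
Qed.

End Mean.

Section HasMean.
Context d (Om : measurableType d) (R : realType) (P : probability Om R).
Implicit Types (f g : Om -> R).

(** [f] is integrable with expectation [m]. *)
Definition has_mean f m := integrable_rv P f /\ mean P f = m.

Lemma has_mean_mean f : integrable_rv P f -> has_mean f (mean P f).
Proof. by []. Qed.

Lemma has_mean_cst r : has_mean (cst r) r.
Proof. by split; [exact: integrable_rv_cst|exact: mean_cst]. Qed.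

Lemma has_meanD f g a b : has_mean f a -> has_mean g b ->
  has_mean (fun w => f w + g w) (a + b).
Proof.
by move=> [fi <-] [gi <-]; split; [exact: integrable_rvD|exact: meanD].
Qed.

Lemma has_meanB f g a b : has_mean f a -> has_mean g b ->
  has_mean (fun w => f w - g w) (a - b).
Proof.
by move=> [fi <-] [gi <-]; split; [exact: integrable_rvB|exact: meanB].
Qed.

Lemma has_meanZ k f a : has_mean f a -> has_mean (fun w => k * f w) (k * a).
Proof. by move=> [fi <-]; split; [exact: integrable_rvZ|exact: meanZ]. Qed.

Lemma has_mean_sum (I : Type) (s : seq I) (f : I -> Om -> R) (a : I -> R) :
  (forall i, has_mean (f i) (a i)) ->
  has_mean (fun w => \sum_(i <- s) f i w) (\sum_(i <- s) a i).
Proof.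
move=> fa; split; first by apply: integrable_rv_sum => i; case: (fa i).
rewrite mean_sum => [|i]; last by case: (fa i).
by apply: eq_bigr => i _; case: (fa i).
Qed.

Lemma le_has_mean f g a b : has_mean f a -> has_mean g b ->
  (forall w, f w <= g w) -> a <= b.
Proof. by move=> [fi <-] [gi <-]; exact: le_mean. Qed.

(** For an i.i.d. process, the expectation of a function of [X t] does not
    depend on [t]. *)
Lemma mean_iid d' (T' : measurableType d') (X : nat -> {RV P >-> T'})
    (f : T' -> R) t :
  iid X -> measurable_fun setT f -> (forall x, 0 <= f x) ->
  mean P (f \o X t) = mean P (f \o X 0%N).
Proof.
move=> [_ Xid] mf f0; rewrite /mean /Rintegral; congr fine.
have mf' : measurable_fun setT (EFin \o f) by exact/measurable_EFinP.
have f0' x : (0 <= (EFin \o f) x)%E by rewrite lee_fin.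
have E s : (\int[P]_w ((f \o X s) w)%:E =
    \int[distribution P (X s)]_x (EFin \o f) x)%E.
  by rewrite (ge0_integral_distribution (X s) mf' f0').
rewrite !E; apply: eq_measure_integral => B mB _; exact: Xid.
Qed.

End HasMean.

(** * One scheduling decision *)

Section Scheduling.
Context (R : realType) (N : nat).
Implicit Types (q s a : N.-tuple nat) (o : option 'I_N).

(** The packets that actually leave queue [i]: the offered service, capped by
    the backlog. *)
Definition departures q s o (i : 'I_N) : nat := minn (tnth q i) (served s o i).

Lemma backlog_stepE q s a o i :
  (tnth (backlog_step q s a o) i)%:R =
  (tnth q i)%:R - (departures q s o i)%:R + (tnth a i)%:R :> R.
Proof.
rewrite tnth_mktuple /departures minnE natrD (natrB _ (leq_subr _ _)).
by rewrite opprB addrCA subrr addr0.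
Qed.

(** Serving less than offered happens only when the queue empties, so the
    unused service is weighted by the departures instead of the backlog. *)
Lemma backlog_mul_served q s o i :
  let m : R := (departures q s o i)%:R in
  let mu : R := (served s o i)%:R in
  (tnth q i)%:R * mu = (tnth q i)%:R * m + m * (mu - m).
Proof.
rewrite /= /departures.
by case: leqP => _; ring.
Qed.

Lemma weighted_service_sum q s o :
  \sum_i (tnth q i)%:R * (served s o i)%:R =
  if o is Some j then (tnth q j * tnth s j)%:R else 0 :> R.
Proof.
case: o => [j|]; last by rewrite big1// => i _; rewrite /served mulr0.
rewrite (bigD1 j)//= big1 => [|i ij].
  by rewrite addr0 natrM /served eqxx.
by rewrite /served (inj_eq Some_inj) eq_sym (negbTE ij) mulr0.
Qed.

(** The expected service that a randomized policy offers to link [i] in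
    channel state [s]. *)
Definition policy_service (policy : N.-tuple nat -> option 'I_N -> R) s i : R :=
  \sum_o policy s o * (served s o i)%:R.

(** The max-weight choice maximizes the weighted service over all decisions,
    hence over all their mixtures. *)
Lemma max_weight_policy policy q s o :
  randomized_policy policy -> max_weight_choice q s o ->
  \sum_i (tnth q i)%:R * policy_service policy s i <=
  \sum_i (tnth q i)%:R * (served s o i)%:R.
Proof.
move=> pol [j -> jmax]; have [pol0 pol1] := pol s.
under eq_bigr do rewrite /policy_service mulr_sumr.
rewrite exchange_big/= weighted_service_sum.
rewrite -[leRHS]mul1r -[X in _ <= X * _]pol1 mulr_suml; apply: ler_sum => o' _.
under eq_bigr do rewrite mulrCA.
rewrite -mulr_sumr; apply: ler_wpM2l => //.
rewrite weighted_service_sum.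
by case: o' => [i|]; rewrite ?ler0n// ler_nat.
Qed.

Lemma policy_service_ge0 policy s i :
  randomized_policy policy -> 0 <= policy_service policy s i.
Proof.
by move=> pol; apply: sumr_ge0 => o _; rewrite mulr_ge0//; case: (pol s).
Qed.

Lemma policy_service_le policy s i (m : nat) :
  randomized_policy policy -> (tnth s i <= m)%N ->
  policy_service policy s i <= m%:R.
Proof.
move=> pol sm; have [pol0 pol1] := pol s.
rewrite -[leRHS]mul1r -[X in _ <= X * _]pol1 mulr_suml; apply: ler_sum => o _.
rewrite ler_wpM2l// ler_nat; apply: leq_trans sm.
by rewrite /served; case: ifP.
Qed.

(** Square of the backlog, corrected by terms linear in it.  When [l] is the
    arrival rate, the term [4 * l * x] makes the departures disappear from the
    expected drift; the term [2 * b * x] replaces [b] times the departures by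
    [b] times the arrivals. *)
Definition lyapunov (l b x : R) : R := x ^+ 2 - 4 * l * x + 2 * b * x.

Lemma lyapunov_ge (l b x : R) :
  0 <= b -> 0 <= x -> - 4 * l ^+ 2 <= lyapunov l b x.
Proof.
move=> b0 x0; rewrite /lyapunov.
have := sqr_ge0 (x - 2 * l); have := mulr_ge0 b0 x0; nra.
Qed.

(** One-slot drift; in expectation the two terms in [m] with factors [l] and [y]
    cancel, as the arrivals are independent of the departures. *)
Lemma lyapunov_drift (l b : R) q s a o i :
  let x : R := (tnth q i)%:R in let y : R := (tnth a i)%:R in
  let m : R := (departures q s o i)%:R in let mu : R := (served s o i)%:R in
  lyapunov l b (tnth (backlog_step q s a o) i)%:R <=
  lyapunov l b x - 2 * (x * mu) + 2 * (x * y) + 2 * (m * mu) - 2 * b * m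
  + 2 * l * m - 2 * (m * y) + (y ^+ 2 - 4 * l * y + 2 * b * y + l ^+ 2).
Proof.
rewrite /= backlog_stepE.
set x : R := (tnth q i)%:R; set y : R := (tnth a i)%:R.
set m : R := (departures q s o i)%:R; set mu : R := (served s o i)%:R.
rewrite /lyapunov.
have E : x * mu = x * m + m * (mu - m) := backlog_mul_served q s o i.
(* the square of [m] is bounded below by its tangent at [l] *)
by rewrite -subr_ge0 E; have := sqr_ge0 (m - l); lra.
Qed.

End Scheduling.

(** * Drift of the queues under max-weight *)

Section MaxWeightSystem.
Context (R : realType) (d : measure_display) (Om : measurableType d)
  (P : probability Om R) (N : nat).
Variables (mu_max : 'I_N -> nat) (lambda : 'rV[R]_N).
Variables (A S Q : nat -> {RV P >-> N.-tuple nat}).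
Context (d' : measure_display) (T' : measurableType d') (U : {RV P >-> T'}).
Variable (sel : nat -> Om -> option 'I_N).
Hypothesis S_le : forall t w i, (tnth (S t w) i <= mu_max i)%N.
Hypothesis S_iid : iid S.
Hypothesis A_iid : iid A.
Hypothesis A_mean : forall t i,
  ('E_P[fun w => (tnth (A t w) i)%:R] = (lambda 0 i)%:E)%E.
Hypothesis A_sq : forall t i,
  ('E_P[fun w => ((tnth (A t w) i)%:R ^+ 2)%R] < +oo)%E.
Hypothesis Q0_sq : forall i,
  ('E_P[fun w => ((tnth (Q 0%N w) i)%:R ^+ 2)%R] < +oo)%E.
Hypothesis A_S_indep : independent P (process_sigma A) (process_sigma S).
Hypothesis Q0_U_indep : independent P
  <<s g_sigma_algebra_preimage (Q 0%N) `|` g_sigma_algebra_preimage U >>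
  <<s process_sigma A `|` process_sigma S >>.
Hypothesis Q_step : forall t w,
  Q t.+1 w = backlog_step (Q t w) (S t w) (A t w) (sel t w).
Hypothesis sel_max_weight : forall t w,
  max_weight_choice (Q t w) (S t w) (sel t w).
Hypothesis sel_nonanticipating : nonanticipating (Q 0%N) U A S sel.

Let hist := history (Q 0%N) U A S.

Lemma preimage_determines (X : {RV P >-> N.-tuple nat}) :
  determines (g_sigma_algebra_preimage X) X.
Proof.
move=> x; exists [set x]; first exact: measurable_tuple_nat.
by rewrite setTI.
Qed.

Lemma determines_sub (G G' : set (set Om)) (T : Type) (X : Om -> T) :
  G `<=` G' -> determines G X -> determines G' X.
Proof. by move=> GG' GX x; exact: GG'. Qed.

Lemma sel_determined t : determines (hist t t.+1) (sel t).
Proof. by move=> o; exact: sel_nonanticipating. Qed.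

(* [Z t] fixes the departures of slot [t], and [W t] also the next backlog. *)
Let Z t w := (Q t w, S t w, sel t w).
Let W t w := (Q t w, S t w, sel t w, A t w).

Lemma decision_determined t :
  determines (hist t t) (Q t) -> determines (hist t t.+1) (Z t).
Proof.
move=> HQ; have sH := history_sigma_algebra (Q 0%N) U A S t t.+1.
apply: determines_pair => //; last exact: sel_determined.
apply: determines_pair => //.
  by apply: determines_sub HQ; apply: history_sub.
by apply: determines_sub (preimage_determines (S t)); apply: history_channel.
Qed.

Lemma slot_determined t :
  determines (hist t t) (Q t) -> determines (hist t.+1 t.+1) (W t).
Proof.
move=> HQ; have sH := history_sigma_algebra (Q 0%N) U A S t.+1 t.+1.
apply: determines_pair => //.
  apply: determines_sub (decision_determined HQ); exact: history_sub.
by apply: determines_sub (preimage_determines (A t)); apply: history_arrival.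
Qed.

Lemma backlog_determined t : determines (hist t t) (Q t).
Proof.
elim: t => [|t IH].
  apply: determines_sub (preimage_determines (Q 0%N)); exact: history_init.
have sH := history_sigma_algebra (Q 0%N) U A S t.+1 t.+1.
pose step (z : N.-tuple nat * N.-tuple nat * option 'I_N * N.-tuple nat) :=
  backlog_step z.1.1.1 z.1.1.2 z.2 z.1.2.
rewrite (_ : (Q t.+1 : Om -> _) = step \o W t).
  exact: determines_comp (slot_determined IH).
by apply/funext => w; exact: Q_step.
Qed.

Lemma slot_measurable t : determines measurable (W t).
Proof.
move=> z; apply: (@history_measurable _ _ _ _ _ _ _ (Q 0%N) U A S t.+1 t.+1).
exact: slot_determined (@backlog_determined t) z.
Qed.

Lemma backlog_channel_independent t q s :
  (P ([set w | Q t w = q] `&` [set w | S t w = s]) =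
   P [set w | Q t w = q] * P [set w | S t w = s])%E.
Proof.
apply: (history_channel_independent A_S_indep Q0_U_indep S_iid.1).
  exact: backlog_determined.
exact: preimage_determines.
Qed.

Lemma decision_arrival_independent t z a :
  (P ([set w | Z t w = z] `&` [set w | A t w = a]) =
   P [set w | Z t w = z] * P [set w | A t w = a])%E.
Proof.
apply: (history_arrival_independent A_S_indep Q0_U_indep A_iid.1).
  exact: decision_determined (@backlog_determined t) z.
exact: preimage_determines.
Qed.

(* The quantities of link [i] on slot [t], as real random variables. *)
Notation backlog t i := (fun w => (tnth (Q t w) i)%:R : R).
Notation arrivals t i := (fun w => (tnth (A t w) i)%:R : R).
Notation service t i := (fun w => (served (S t w) (sel t w) i)%:R : R).
Notation departed t i :=
  (fun w => (departures (Q t w) (S t w) (sel t w) i)%:R : R).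

Lemma slot_measurable_fun t (f : _ -> R) : measurable_fun setT (f \o W t).
Proof. exact: determines_measurable_fun (@slot_measurable t). Qed.

Lemma arrivals_sq_integrable t i : integrable_rv P (fun w => arrivals t i w ^+ 2).
Proof.
apply/integrableP; split.
  apply/measurable_EFinP.
  exact: (@slot_measurable_fun t (fun z => (tnth z.2 i)%:R ^+ 2)).
have := A_sq t i; rewrite unlock => sq.
by under eq_integral do rewrite /= ger0_norm ?sqr_ge0//.
Qed.

Lemma backlog_sq_integrable t i : integrable_rv P (fun w => backlog t i w ^+ 2).
Proof.
elim: t => [|t IH].
  apply/integrableP; split.
    apply/measurable_EFinP.
    exact: (@slot_measurable_fun 0%N (fun z => (tnth z.1.1.1 i)%:R ^+ 2)).
  have := Q0_sq i; rewrite unlock => sq.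
  by under eq_integral do rewrite /= ger0_norm ?sqr_ge0//.
have intG := integrable_rvZ 2 (integrable_rvD IH (arrivals_sq_integrable t i)).
apply: le_integrable_rv intG.
  exact: (@slot_measurable_fun t.+1 (fun z => (tnth z.1.1.1 i)%:R ^+ 2)).
move=> w; rewrite Q_step backlog_stepE ger0_norm ?sqr_ge0//.
set x : R := (tnth (Q t w) i)%:R; set y : R := (tnth (A t w) i)%:R.
set m : R := (departures _ _ _ _)%:R.
have m0 : 0 <= m by exact: ler0n.
have mx : m <= x by rewrite ler_nat geq_minl.
have y0 : 0 <= y by exact: ler0n.
have := sqr_ge0 (x - y); nra.
Qed.

(** Integrability by domination; the bound dominates each term of the one-slot
    drift. *)
Lemma slot_integrable t i (f : _ -> R) :
  (forall w, `|f (W t w)| <=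
    backlog t i w ^+ 2 + arrivals t i w ^+ 2 + (mu_max i)%:R ^+ 2) ->
  integrable_rv P (f \o W t).
Proof.
move=> fG; apply: (le_integrable_rv _ fG).
  exact: slot_measurable_fun.
apply: integrable_rvD; last exact: integrable_rv_cst.
exact: integrable_rvD (backlog_sq_integrable t i) (arrivals_sq_integrable t i).
Qed.

Lemma ler_nat_sqr (n : nat) : n%:R <= n%:R ^+ 2 :> R.
Proof. by rewrite -natrX ler_nat; case: n => // n; rewrite -mulnn leq_pmulr. Qed.

Lemma service_le t i w : service t i w <= (mu_max i)%:R.
Proof.
by rewrite ler_nat; apply: leq_trans (S_le t w i); rewrite /served; case: ifP.
Qed.

Lemma departed_le_service t i w : departed t i w <= service t i w.
Proof. by rewrite ler_nat geq_minr. Qed.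

Lemma backlog_integrable t i : integrable_rv P (backlog t i).
Proof.
apply: (@slot_integrable t i (fun z => (tnth z.1.1.1 i)%:R)) => w /=.
rewrite normr_nat; have := ler_nat_sqr (tnth (Q t w) i).
by have := sqr_ge0 (arrivals t i w); have := sqr_ge0 ((mu_max i)%:R : R); lra.
Qed.

Lemma arrivals_integrable t i : integrable_rv P (arrivals t i).
Proof.
apply: (@slot_integrable t i (fun z => (tnth z.2 i)%:R)) => w /=.
rewrite normr_nat; have := ler_nat_sqr (tnth (A t w) i).
by have := sqr_ge0 (backlog t i w); have := sqr_ge0 ((mu_max i)%:R : R); lra.
Qed.

Lemma departed_integrable t i : integrable_rv P (departed t i).
Proof.
apply: (@slot_integrable t i
  (fun z => (departures z.1.1.1 z.1.1.2 z.1.2 i)%:R)) => w /=.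
rewrite normr_nat; have := ler_nat_sqr (mu_max i).
have := departed_le_service t i w; have := service_le t i w.
by have := sqr_ge0 (backlog t i w); have := sqr_ge0 (arrivals t i w); lra.
Qed.

Lemma backlog_service_integrable t i :
  integrable_rv P (fun w => backlog t i w * service t i w).
Proof.
apply: (@slot_integrable t i
  (fun z => (tnth z.1.1.1 i)%:R * (served z.1.1.2 z.1.2 i)%:R)) => w /=.
rewrite normrM !normr_nat.
have := service_le t i w.
have := sqr_ge0 (arrivals t i w).
have s0 : 0 <= service t i w by exact: ler0n.
move: s0; set x : R := (tnth (Q t w) i)%:R; set mu : R := (served _ _ _)%:R.
by have := sqr_ge0 (x - mu); nra.
Qed.

Lemma departed_service_integrable t i :
  integrable_rv P (fun w => departed t i w * service t i w).
Proof.
apply: (@slot_integrable t i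
  (fun z => (departures z.1.1.1 z.1.1.2 z.1.2 i)%:R *
            (served z.1.1.2 z.1.2 i)%:R)) => w /=.
rewrite normrM !normr_nat.
have := sqr_ge0 (arrivals t i w); have := sqr_ge0 (backlog t i w).
have := departed_le_service t i w; have := service_le t i w.
have : 0 <= departed t i w by exact: ler0n.
by nra.
Qed.

Notation backlog_mean t i := (mean P (backlog t i)).

Lemma has_mean_arrivals t i : has_mean P (arrivals t i) (lambda 0 i).
Proof.
by split; [exact: arrivals_integrable|exact: mean_expectation (A_mean t i)].
Qed.

Lemma measurable_fun_tuple_nat (f : N.-tuple nat -> R) : measurable_fun setT f.
Proof. by move=> _ B _; exact: measurable_tuple_nat. Qed.

Lemma has_mean_arrivals_sq t i :
  has_mean P (fun w => arrivals t i w ^+ 2) (second_moment (A 0%N) i).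
Proof.
split; first exact: arrivals_sq_integrable.
rewrite (mean_iid (f := fun a => (tnth a i)%:R ^+ 2) t A_iid)//.
  by rewrite /second_moment (expectation_mean (arrivals_sq_integrable 0 i)).
exact: measurable_fun_tuple_nat.
Qed.

Lemma channel_measurable t : determines measurable (S t).
Proof. by move=> s; exact: preimage_measurable (preimage_determines (S t) s). Qed.

Lemma arrival_measurable t : determines measurable (A t).
Proof. by move=> s; exact: preimage_measurable (preimage_determines (A t) s). Qed.

Lemma backlog_measurable t : determines measurable (Q t).
Proof. by move=> s; exact: preimage_measurable (preimage_determines (Q t) s). Qed.

Lemma decision_measurable t : determines measurable (Z t).
Proof.
move=> z; apply: (@history_measurable _ _ _ _ _ _ _ (Q 0%N) U A S t t.+1).
exact: decision_determined (@backlog_determined t) z.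
Qed.

Lemma has_mean_mul_arrivals t i (f : _ -> R) : (forall z, 0 <= f z) ->
  integrable_rv P (f \o Z t) ->
  has_mean P (fun w => f (Z t w) * arrivals t i w)
    (mean P (f \o Z t) * lambda 0 i).
Proof.
move=> f0 intf; have [_ <-] := has_mean_arrivals t i.
apply: (mean_mul_independent (g := fun a => (tnth a i)%:R)) => //.
- exact: decision_measurable.
- exact: arrival_measurable.
- exact: decision_arrival_independent.
- exact: arrivals_integrable.
Qed.

Lemma policy_service_integrable policy t i : randomized_policy policy ->
  integrable_rv P (fun w => policy_service policy (S t w) i).
Proof.
move=> pol; apply: (@le_integrable_rv _ _ _ _ _ (cst (mu_max i)%:R)).
- exact: (determines_measurable_fun (policy_service policy ^~ i)
    (@channel_measurable t)).
- move=> w /=; rewrite ger0_norm ?policy_service_ge0//.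
  exact: policy_service_le.
- exact: integrable_rv_cst.
Qed.

Lemma has_mean_backlog_policy policy t i (r : R) : randomized_policy policy ->
  policy_rate (S 0%N) policy i = r%:E ->
  has_mean P (fun w => backlog t i w * policy_service policy (S t w) i)
    (backlog_mean t i * r).
Proof.
move=> pol polr.
have -> : r = mean P (fun w => policy_service policy (S t w) i).
  rewrite (@mean_iid _ _ _ _ _ _ S (policy_service policy ^~ i) t S_iid).
  - by rewrite -(mean_expectation polr).
  - exact: measurable_fun_tuple_nat.
  - by move=> s; exact: policy_service_ge0.
apply: (mean_mul_independent (f := fun q => (tnth q i)%:R)
  (g := policy_service policy ^~ i)).
- exact: backlog_measurable.
- exact: channel_measurable.
- by move=> q; exact: ler0n.
- by move=> s; exact: policy_service_ge0.
- exact: backlog_channel_independent.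
- exact: backlog_integrable.
- exact: policy_service_integrable.
Qed.

(** Expected weighted service under max-weight dominates that of any vector
    of the capacity region. *)
Lemma max_weight_capacity x t : capacity_region (S 0%N) x ->
  \sum_i backlog_mean t i * x 0 i <=
  \sum_i mean P (fun w => backlog t i w * service t i w).
Proof.
move=> [_ [policy pol polx]].
apply: (@le_has_mean _ _ _ P
  (fun w => \sum_i backlog t i w * policy_service policy (S t w) i)
  (fun w => \sum_i backlog t i w * service t i w)).
- by apply: has_mean_sum => i; exact: has_mean_backlog_policy.
- apply: has_mean_sum => i; exact/has_mean_mean/backlog_service_integrable.
- by move=> w; exact: max_weight_policy.
Qed.

(** Expected value of the Lyapunov function of the system on slot [t]. *)
Definition mean_lyapunov (b : 'I_N -> R) t :=
  \sum_i mean P (fun w => lyapunov (lambda 0 i) (b i) (backlog t i w)).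

Lemma has_mean_lyapunov (b : R) t i :
  has_mean P (fun w => lyapunov (lambda 0 i) b (backlog t i w))
    (mean P (fun w => lyapunov (lambda 0 i) b (backlog t i w))).
Proof.
apply: has_mean_mean; apply: integrable_rvD; last first.
  exact/integrable_rvZ/backlog_integrable.
apply: integrable_rvB; first exact: backlog_sq_integrable.
exact/integrable_rvZ/backlog_integrable.
Qed.

Lemma mean_lyapunov_ge (b : 'I_N -> R) t : (forall i, 0 <= b i) ->
  \sum_i (- 4 * lambda 0 i ^+ 2) <= mean_lyapunov b t.
Proof.
move=> b0; apply: ler_sum => i _.
apply: le_has_mean (has_mean_cst P _) (has_mean_lyapunov (b i) t i) _ => w.
exact: lyapunov_ge.
Qed.

(** The expected drift of one link.  The tangent bound contributes
    [l ^+ 2] to the constant, and the correction [4 * l * x] contributes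
    [- 4 * l ^+ 2]. *)
Lemma mean_link_drift (b : R) t i :
  mean P (fun w => lyapunov (lambda 0 i) b (backlog t.+1 i w)) <=
  mean P (fun w => lyapunov (lambda 0 i) b (backlog t i w))
  - 2 * mean P (fun w => backlog t i w * service t i w)
  + 2 * (backlog_mean t i * lambda 0 i)
  + 2 * (mean P (fun w => departed t i w * service t i w)
         - b * mean P (departed t i))
  + (second_moment (A 0%N) i - 3 * lambda 0 i ^+ 2 + 2 * (b * lambda 0 i)).
Proof.
set l := lambda 0 i.
have Eql := has_mean_lyapunov b t i; rewrite -/l in Eql.
have Eqs := has_mean_mean (backlog_service_integrable t i).
have Eqa : has_mean P (fun w => backlog t i w * arrivals t i w)
    (backlog_mean t i * l).
  apply: (has_mean_mul_arrivals i (f := fun z => (tnth z.1.1 i)%:R)) => //.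
  exact: backlog_integrable.
have Ems := has_mean_mean (departed_service_integrable t i).
have Em := has_mean_mean (departed_integrable t i).
have Ema : has_mean P (fun w => departed t i w * arrivals t i w)
    (mean P (departed t i) * l).
  apply: (has_mean_mul_arrivals i
    (f := fun z => (departures z.1.1 z.1.2 z.2 i)%:R)) => //.
  exact: departed_integrable.
have Ea := has_mean_arrivals t i; have Ea2 := has_mean_arrivals_sq t i.
have Erhs := has_meanD (has_meanB (has_meanD (has_meanB (has_meanD (has_meanD
  (has_meanB Eql (has_meanZ 2 Eqs)) (has_meanZ 2 Eqa)) (has_meanZ 2 Ems))
  (has_meanZ (2 * b) Em)) (has_meanZ (2 * l) Em)) (has_meanZ 2 Ema))
  (has_meanD (has_meanD (has_meanB Ea2 (has_meanZ (4 * l) Ea))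
    (has_meanZ (2 * b) Ea)) (has_mean_cst P (l ^+ 2))).
have := le_has_mean (has_mean_lyapunov b t.+1 i) Erhs.
rewrite -/l => drift; apply: le_trans (drift _) _; last by lra.
by move=> w; rewrite /= Q_step; exact: lyapunov_drift.
Qed.

(** With [b = mu_max] every summand is nonpositive, as no rate exceeds the
    maximal one. *)
Lemma le_departed_service_mu_max t :
  \sum_i (mean P (fun w => departed t i w * service t i w)
          - (mu_max i)%:R * mean P (departed t i)) <= 0.
Proof.
apply: sumr_le0 => i _; rewrite subr_le0.
apply: le_has_mean (has_mean_mean (departed_service_integrable t i))
  (has_meanZ _ (has_mean_mean (departed_integrable t i))) _ => w /=.
by rewrite mulrC ler_wpM2r// service_le.
Qed.

(** With [b = 0] only the served link contributes, at most the square of its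
    rate. *)
Lemma le_departed_service_max t :
  \sum_i (mean P (fun w => departed t i w * service t i w)
          - 0 * mean P (departed t i)) <= max_rate_second_moment (S 0%N).
Proof.
under eq_bigr do rewrite mul0r subr0.
pose f (s : N.-tuple nat) : R := ((\max_(i < N) tnth s i ^ 2)%N)%:R.
have intf u : integrable_rv P (f \o S u).
  apply: (@le_integrable_rv _ _ _ _ _
      (cst ((\max_(i < N) mu_max i ^ 2)%N)%:R)).
  - exact: (determines_measurable_fun f (@channel_measurable u)).
  - move=> w /=; rewrite normr_nat ler_nat; apply/bigmax_leqP => i _.
    by apply: leq_trans (leq_bigmax i); rewrite leq_sqr.
  - exact: integrable_rv_cst.
have -> : max_rate_second_moment (S 0%N) = mean P (f \o S t).
  rewrite (mean_iid t S_iid) => [||s]; last exact: ler0n.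
    by rewrite /max_rate_second_moment (expectation_mean (intf 0%N)).
  exact: measurable_fun_tuple_nat.
apply: (@le_has_mean _ _ _ P
  (fun w => \sum_i departed t i w * service t i w) (f \o S t)).
- apply: has_mean_sum => i; exact/has_mean_mean/departed_service_integrable.
- exact: has_mean_mean.
- move=> w /=; case: (sel_max_weight t w) => j -> _.
  rewrite (bigD1 j)//= big1 ?addr0 => [|i ij]; last first.
    by rewrite /served (inj_eq Some_inj) eq_sym (negbTE ij) mulr0.
  rewrite -natrM ler_nat; apply: leq_trans (leq_bigmax j).
  by rewrite -mulnn leq_mul// /departures /served eqxx// geq_minr.
Qed.

Section Load.
Variables (rho : R) (x : 'rV[R]_N).
Hypothesis rho_gt0 : 0 < rho.
Hypothesis rho_lt1 : rho < 1.
Hypothesis x_cap : capacity_region (S 0%N) x.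
Hypothesis lambda_x : lambda = rho *: x.

(** [rho *: x + (1 - rho) *: y] is a convex combination in the capacity
    region, and exceeds [lambda] by [(1 - rho) *: y]. *)
Lemma mean_drift (b : 'I_N -> R) (M : R) (y : 'rV[R]_N) t :
  capacity_region (S 0%N) y ->
  \sum_i (mean P (fun w => departed t i w * service t i w)
          - b i * mean P (departed t i)) <= M ->
  mean_lyapunov b t.+1 <= mean_lyapunov b t
    - 2 * (1 - rho) * (\sum_i backlog_mean t i * y 0 i)
    + (\sum_i (second_moment (A 0%N) i - 3 * lambda 0 i ^+ 2)
       + 2 * (\sum_i b i * lambda 0 i + M)).
Proof.
move=> y_cap leM.
have capx := max_weight_capacity t x_cap.
have capy := max_weight_capacity t y_cap.
have lamE : \sum_i backlog_mean t i * lambda 0 i =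
    rho * \sum_i backlog_mean t i * x 0 i.
  by rewrite mulr_sumr; apply: eq_bigr => i _; rewrite lambda_x mxE mulrCA.
have {capx}capx := ler_wpM2l (ltW rho_gt0) capx.
have {capy}capy : (1 - rho) * \sum_i backlog_mean t i * y 0 i <=
    (1 - rho) * \sum_i mean P (fun w => backlog t i w * service t i w).
  by rewrite ler_wpM2l// subr_ge0 ltW.
rewrite -lamE in capx.
apply: (le_trans (ler_sum _ (fun i _ => mean_link_drift (b i) t i))).
set M' := (X in X <= M) in leM.
set qs := (X in _ <= (1 - rho) * X) in capy; rewrite -/qs in capx.
rewrite (_ : \sum_i _ = mean_lyapunov b t - 2 * qs
    + 2 * (\sum_i backlog_mean t i * lambda 0 i) + 2 * M'
    + (\sum_i (second_moment (A 0%N) i - 3 * lambda 0 i ^+ 2)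
       + 2 * \sum_i b i * lambda 0 i)).
  by lra.
rewrite /mean_lyapunov !mulr_sumr -sumrB -!big_split/=.
by apply: eq_bigr => i _; ring.
Qed.

(** Half the constant of the drift inequality, with the smaller of the two
    bounds on the expectation of departures times offered service. *)
Definition drift_bound : R :=
  2^-1 * \sum_i second_moment (A 0%N) i - 3 / 2 * \sum_i lambda 0 i ^+ 2
  + Num.min (\sum_i lambda 0 i * (mu_max i)%:R) (max_rate_second_moment (S 0%N)).

Lemma mean_drift_sum (b : 'I_N -> R) (M : R) (y : 'rV[R]_N) :
  capacity_region (S 0%N) y -> (forall i, 0 <= b i) ->
  (forall t, \sum_i (mean P (fun w => departed t i w * service t i w)
          - b i * mean P (departed t i)) <= M) ->
  exists C, forall t,
    2 * (1 - rho) * (\sum_(0 <= u < t) \sum_i backlog_mean u i * y 0 i) <=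
    (\sum_i (second_moment (A 0%N) i - 3 * lambda 0 i ^+ 2)
       + 2 * (\sum_i b i * lambda 0 i + M)) * t%:R + C.
Proof.
move=> y_cap b0 leM; set K := (_ + 2 * (_ + M)).
exists (mean_lyapunov b 0 - \sum_i (- 4 * lambda 0 i ^+ 2)) => t.
suff H : mean_lyapunov b t +
    2 * (1 - rho) * (\sum_(0 <= u < t) \sum_i backlog_mean u i * y 0 i) <=
    mean_lyapunov b 0 + K * t%:R.
  by have := mean_lyapunov_ge t b0; lra.
elim: t => [|t IH]; first by rewrite big_geq// !mulr0 !addr0.
rewrite big_nat_recr//= -natr1.
have := mean_drift y_cap (leM t); rewrite -/K; lra.
Qed.

(** The minimum in [drift_bound] comes from the two choices [b = mu_max] and
    [b = 0] in the Lyapunov function. *)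
Lemma backlog_sum_bound (y : 'rV[R]_N) : capacity_region (S 0%N) y ->
  exists2 C, 0 <= C & forall t,
    (1 - rho) * (\sum_(0 <= u < t) \sum_i backlog_mean u i * y 0 i) <=
    drift_bound * t%:R + C.
Proof.
move=> y_cap.
suff [C HC] : exists C, forall t,
    2 * (1 - rho) * (\sum_(0 <= u < t) \sum_i backlog_mean u i * y 0 i) <=
    2 * drift_bound * t%:R + C.
  exists (2^-1 * C) => [|t]; last by have := HC t; lra.
  by have := HC 0%N; rewrite big_geq// !mulr0 add0r; lra.
have sumE : \sum_i (second_moment (A 0%N) i - 3 * lambda 0 i ^+ 2) =
    \sum_i second_moment (A 0%N) i - 3 * \sum_i lambda 0 i ^+ 2.
  by rewrite sumrB -mulr_sumr.
rewrite /drift_bound; case: leP => _.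
- have [C HC] := mean_drift_sum (b := fun i => (mu_max i)%:R) y_cap
    (fun i => ler0n _ _) le_departed_service_mu_max.
  exists C => t; have := HC t; rewrite sumE.
  have -> : \sum_i (mu_max i)%:R * lambda 0 i = \sum_i lambda 0 i * (mu_max i)%:R.
    by apply: eq_bigr => i _; rewrite mulrC.
  lra.
- have [C HC] := mean_drift_sum (b := fun=> 0) y_cap (fun=> lexx 0)
    le_departed_service_max.
  exists C => t; have := HC t; rewrite sumE.
  have -> : \sum_i 0 * lambda 0 i = 0 by rewrite big1// => i _; rewrite mul0r.
  lra.
Qed.

(** The time average of the expected backlog of link [i] over [t] slots; it is
    zero for [t = 0], since [0^-1 = 0]. *)
Definition backlog_average i t : R :=
  t%:R^-1 * \sum_(0 <= u < t) backlog_mean u i.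

Lemma time_averageE i t : time_average Q i t = (backlog_average i t)%:E.
Proof.
rewrite /time_average /backlog_average EFinM -sumEFin; congr (_ * _)%E.
by apply: eq_bigr => u _; rewrite (expectation_mean (backlog_integrable u i)).
Qed.

Lemma backlog_mean_ge0 t i : 0 <= backlog_mean t i.
Proof. by apply: mean_ge0 => w; exact: ler0n. Qed.

Lemma backlog_average_ge0 i t : 0 <= backlog_average i t.
Proof.
rewrite mulr_ge0 ?invr_ge0 ?ler0n// sumr_ge0// => u _; exact: backlog_mean_ge0.
Qed.

Lemma backlog_average_bound (y : 'rV[R]_N) : capacity_region (S 0%N) y ->
  exists2 C, 0 <= C & forall t, (0 < t)%N ->
    (1 - rho) * (\sum_i backlog_average i t * y 0 i) <=
    drift_bound + C * t%:R^-1.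
Proof.
move=> /backlog_sum_bound[C C0 HC]; exists C => // t t0.
have tp : 0 < t%:R :> R by rewrite ltr0n.
have -> : \sum_i backlog_average i t * y 0 i =
    t%:R^-1 * \sum_(0 <= u < t) \sum_i backlog_mean u i * y 0 i.
  rewrite exchange_big mulr_sumr; apply: eq_bigr => i _ /=.
  by rewrite /backlog_average -mulrA mulr_suml.
rewrite mulrCA [leLHS]mulrC ler_pdivrMr// [leRHS]mulrDl divfK//.
by rewrite gt_eqF.
Qed.

(** If [x 0 i = 0] then link [i] has no arrivals and its expected backlog does
    not increase; otherwise the average bound for [x] applies to it. *)
Lemma backlog_average_bounded i : exists K, forall t, backlog_average i t <= K.
Proof.
have x0 : 0 <= x 0 i by case: x_cap.
have rho1 : 0 < 1 - rho by rewrite subr_gt0.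
move: x0; rewrite le_eqVlt => /orP[/eqP xi0|xi].
  have lam0 : lambda 0 i = 0 by rewrite lambda_x mxE -xi0 mulr0.
  have q0 t : backlog_mean t i <= backlog_mean 0 i.
    elim: t => // t; apply: le_trans.
    have := has_meanD (has_mean_mean (backlog_integrable t i))
      (has_mean_arrivals t i).
    rewrite lam0 addr0.
    move=> /(le_has_mean (has_mean_mean (backlog_integrable t.+1 i))); apply.
    move=> w; rewrite Q_step backlog_stepE lerD2r gerBl; exact: ler0n.
  exists (backlog_mean 0 i) => -[|t].
    by rewrite /backlog_average big_geq// mulr0 backlog_mean_ge0.
  rewrite /backlog_average mulrC ler_pdivrMr ?ltr0n//.
  rewrite (le_trans (ler_sum _ (fun u _ => q0 u)))//.
  by rewrite sumr_const_nat subn0 mulr_natr.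
have [C C0 HC] := backlog_average_bound x_cap.
pose c := (1 - rho) * x 0 i; have c0 : 0 < c by exact: mulr_gt0.
exists (c^-1 * (`|drift_bound| + C)) => -[|t].
  rewrite /backlog_average big_geq// mulr0.
  by apply: mulr_ge0; [rewrite invr_ge0 ltW|exact: addr_ge0].
rewrite mulrC ler_pdivlMr//.
apply: (@le_trans _ _ (drift_bound + C * t.+1%:R^-1)); last first.
  rewrite lerD ?ler_norm// ler_piMr// invf_le1 ?ltr0n// ler1n//.
apply: le_trans (HC t.+1 isT).
rewrite /c mulrCA ler_pM2l// (bigD1 i)//= lerDl sumr_ge0// => j _.
by rewrite mulr_ge0 ?backlog_average_ge0//; case: x_cap.
Qed.

Lemma max_weight_stable : stable Q.
Proof.
move=> i; have [K HK] := backlog_average_bounded i.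
apply: (@le_lt_trans _ _ K%:E); last exact: ltry.
apply: (@le_trans _ _ (ereal_sup (time_average Q i @` setT))).
  by apply: ereal_inf_lbound; exists setT => //; exact: filterT.
by apply: ge_ereal_sup => _ [t _ <-]; rewrite time_averageE lee_fin.
Qed.

Lemma max_weight_delay (mu_sym : R) : 0 < mu_sym ->
  symmetric_rates (S 0%N) mu_sym ->
  (forall i, cvgn (time_average Q i)) ->
  (\sum_(i < N) limn (time_average Q i) <=
    (N%:R / ((1 - rho) * mu_sym) * drift_bound)%:E)%E.
Proof.
move=> mu0 mu_cap cvgQ.
have rho1 : 0 < 1 - rho by rewrite subr_gt0.
have [N0|N0] := posnP N.
  rewrite big1 ?N0 ?mul0r// => i _; exfalso.
  by have := ltn_ord i; rewrite {2}N0.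
have [C C0 HC] := backlog_average_bound mu_cap.
set c := N%:R / _.
have c0 : 0 < c by rewrite divr_gt0 ?ltr0n// mulr_gt0.
have avg_le t : (0 < t)%N ->
    (\sum_(i < N) time_average Q i t <= (c * (drift_bound + C * t%:R^-1))%:E)%E.
  move=> t0; under eq_bigr do rewrite time_averageE.
  rewrite sumEFin lee_fin -ler_pdivrMl//.
  apply: le_trans (HC t t0).
  have -> : \sum_i backlog_average i t * const_mx (mu_sym / N%:R) (0 : 'I_1) i =
      (\sum_i backlog_average i t) * (mu_sym / N%:R).
    by rewrite mulr_suml; apply: eq_bigr => i _; rewrite mxE.
  rewrite /c invf_div le_eqVlt; apply/orP; left; apply/eqP.
  by field; rewrite pnatr_eq0 -lt0n N0.
have cvg_sumQ : (fun t => \sum_(i < N) time_average Q i t)%E @ \oo -->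
    (\sum_(i < N) limn (time_average Q i))%E.
  apply: cvg_nnesum => i _; last exact: cvgQ.
  by apply: nearW => t; rewrite time_averageE lee_fin backlog_average_ge0.
have cvg_bound : (fun t : nat => (c * (drift_bound + C * t%:R^-1))%:E) @ \oo -->
    (c * drift_bound)%:E.
  apply/fine_cvgP; split; first exact: nearW.
  apply: cvgMl_tmp; rewrite -[X in _ --> X]addr0.
  apply: cvgD; first exact: cvg_cst.
  rewrite -[X in _ --> X](mulr0 C); apply: cvgMl_tmp.
  by rewrite -cvg_shiftS; exact: cvg_harmonic.
rewrite -(cvg_lim _ cvg_sumQ)// -(cvg_lim _ cvg_bound)//.
apply: lee_lim; [exact: cvgP cvg_sumQ|exact: cvgP cvg_bound|].
by exists 1%N => // t /= t0; exact: avg_le.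
Qed.

End Load.

End MaxWeightSystem.

(** * Uniform choice from a random subset *)

Section Thinning.
Context (R : realFieldType) (I : finType).
Implicit Types (J K : {set I}) (i j : I).

(** Probability that [J] is the outcome of including each [j] independently
    with probability [v j]. *)
Definition subset_weight (v : I -> R) J : R :=
  \prod_j (if j \in J then v j else 1 - v j).

Lemma subset_weight_ge0 v J : (forall j, 0 <= v j <= 1) ->
  0 <= subset_weight v J.
Proof.
move=> v01; apply: prodr_ge0 => j _; have /andP[v0 v1] := v01 j.
by case: ifP => // _; rewrite subr_ge0.
Qed.

Lemma sum_subset_weight v : \sum_J subset_weight v J = 1.
Proof.
rewrite -bigA_distr; apply: big1 => j _ /=.
by rewrite addrC subrK.
Qed.

(** Probability of drawing [i] when a random subset of weight [v] is drawn
    first, and then one of its elements uniformly. *)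
Definition uniform_pick (v : I -> R) i : R :=
  \sum_(J : {set I} | i \in J) #|J|%:R^-1 * subset_weight v J.

Lemma uniform_pick_ge0 v i : (forall j, 0 <= v j <= 1) -> 0 <= uniform_pick v i.
Proof.
move=> v01; apply: sumr_ge0 => J _.
by rewrite mulr_ge0 ?invr_ge0 ?ler0n// subset_weight_ge0.
Qed.

Lemma sum_uniform_pick v :
  \sum_i uniform_pick v i = 1 - \prod_j (1 - v j).
Proof.
have w0 : subset_weight v finset.set0 = \prod_j (1 - v j).
  by apply: eq_bigr => j _; rewrite inE.
have -> : 1 - \prod_j (1 - v j) =
    \sum_(J : {set I} | J != finset.set0) subset_weight v J.
  have := sum_subset_weight v.
  rewrite (bigD1 (finset.set0 : {set I}))//= w0; lra.
rewrite /uniform_pick (exchange_big_dep xpredT)//=.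
rewrite (bigD1 (finset.set0 : {set I}))//= big_pred0 ?add0r => [|i]; last first.
  by rewrite inE.
apply: eq_bigr => J J0; rewrite -mulr_suml sumr_const.
by rewrite -[X in X * _ = _]mulr_natr mulVf ?mul1r// pnatr_eq0 cards_eq0.
Qed.

Lemma uniform_pick_eq0 v i : v i = 0 -> uniform_pick v i = 0.
Proof.
move=> vi; apply: big1 => J iJ.
by rewrite /subset_weight (bigD1 i)//= iJ vi mul0r mulr0.
Qed.

Lemma subset_weight_cst (p : R) J :
  subset_weight (fun=> p) J = p ^+ #|J| * (1 - p) ^+ (#|I| - #|J|).
Proof.
rewrite -(cardsC J) addKn /subset_weight (bigID (mem J))/=; congr (_ * _).
  rewrite -prodr_const; apply: eq_bigr => j jJ; by rewrite jJ.
rewrite -prodr_const; apply: eq_big => j; first by rewrite inE.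
by move=> /negbTE ->.
Qed.

Lemma uniform_pick_cst_sym (p : R) i j :
  uniform_pick (fun=> p) i = uniform_pick (fun=> p) j.
Proof.
have injt : injective (fun J : {set I} => tperm i j @: J).
  by apply: imset_inj; exact: perm_inj.
rewrite /uniform_pick (reindex_inj injt)/=; apply: eq_big => J.
  by rewrite -{1}(tpermR i j) mem_imset//; exact: perm_inj.
move=> _; rewrite !subset_weight_cst card_imset//; exact: perm_inj.
Qed.

Lemma uniform_pick_cst (p : R) i :
  uniform_pick (fun=> p) i = (1 - (1 - p) ^+ #|I|) / #|I|%:R.
Proof.
have I0 : #|I|%:R != 0 :> R.
  by rewrite pnatr_eq0 -lt0n; apply/card_gt0P; exists i.
apply: (mulIf I0); rewrite divfK// -[in RHS]prodr_const.
rewrite (eq_bigl xpredT)// -(sum_uniform_pick (fun=> p)).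
rewrite (eq_bigr (fun=> uniform_pick (fun=> p) i)) => [|j _].
  by rewrite sumr_const mulr_natr.
exact: uniform_pick_cst_sym.
Qed.

(** Thinning: if [K] is drawn with inclusion probabilities [p j] and each of
    its elements is then kept with probability [t j], the result has inclusion
    probabilities [p j * t j]. *)
Lemma subset_weight_thin (p t : I -> R) J :
  \sum_K subset_weight p K * subset_weight (fun j => if j \in K then t j else 0) J
  = subset_weight (fun j => p j * t j) J.
Proof.
under eq_bigr do rewrite -big_split/=.
pose F j := p j * (if j \in J then t j else 1 - t j).
pose G j := (1 - p j) * (if j \in J then 0 else 1).
rewrite (eq_bigr (fun K : {set I} => \prod_j (if j \in K then F j else G j))).
  rewrite -bigA_distr; apply: eq_bigr => j _; rewrite /F /G.
  by case: (j \in J) => /=; ring.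
move=> K _; apply: eq_bigr => j _; rewrite /F /G.
by case: (j \in K); case: (j \in J); rewrite ?subr0.
Qed.

Lemma uniform_pick_thin (p t : I -> R) i :
  \sum_K subset_weight p K * uniform_pick (fun j => if j \in K then t j else 0) i
  = uniform_pick (fun j => p j * t j) i.
Proof.
rewrite /uniform_pick; under eq_bigr do rewrite mulr_sumr.
rewrite exchange_big/=; apply: eq_bigr => J _.
rewrite -subset_weight_thin mulr_sumr; apply: eq_bigr => K _.
by rewrite mulrCA.
Qed.

End Thinning.

(** * A lower bound on the symmetric rate *)

Section SymmetricRate.
Context (R : realType) (d : measure_display) (Om : measurableType d)
  (P : probability Om R) (N : nat).
Variables (S : {RV P >-> N.-tuple nat}) (mu_max : 'I_N -> nat) (m : nat).
Hypothesis S_le : forall w i, (tnth (S w) i <= mu_max i)%N.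

(** The links whose rate reaches [m] in channel state [s]. *)
Definition fast_links (s : N.-tuple nat) : {set 'I_N} :=
  [set i | m <= tnth s i]%SET%N.

(** Probability that link [i] is fast. *)
Definition fast_prob i : R := fine (P [set w | (m <= tnth (S w) i)%N]).

Lemma measurable_event (B : set (N.-tuple nat)) : measurable [set w | B (S w)].
Proof. by apply: measurable_funPTI; exact: measurable_tuple_nat. Qed.

Lemma has_mean_event (B : set (N.-tuple nat)) :
  has_mean P (fun w => \1_[set w | B (S w)] w) (fine (P [set w | B (S w)])).
Proof.
split; first exact: integrable_indic (measurable_event B).
by rewrite /mean /Rintegral integral_indic ?setIT//; exact: measurable_event.
Qed.

(* Independence across links, for the events that concern one link each. *)
Hypothesis S_indep : forall E : 'I_N -> set nat,
  (P (\bigcap_i [set w | E i (tnth (S w) i)]) =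
   \prod_i P [set w | E i (tnth (S w) i)])%E.

Lemma prob_fast_links (K : {set 'I_N}) :
  fine (P [set w | fast_links (S w) = K]) = subset_weight fast_prob K.
Proof.
pose E i := [set n | (m <= n)%N = (i \in K)].
have -> : [set w | fast_links (S w) = K] =
    \bigcap_i [set w | E i (tnth (S w) i)].
  apply/seteqP; split => w /=.
    by move=> wK i _; rewrite /E /= -wK inE.
  by move=> Ew; apply/setP => i; rewrite inE; exact: (Ew i).
have PE i : P [set w | E i (tnth (S w) i)] =
    (if i \in K then fast_prob i else 1 - fast_prob i)%:E.
  have mi := measurable_event [set s | (m <= tnth s i)%N].
  rewrite /E /fast_prob; case: ifP => iK.
    by rewrite fineK ?fin_num_measure.
  rewrite EFinB fineK ?fin_num_measure// -probability_setC//.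
  congr (P _); apply/seteqP; split => w /=; first by move=> ->.
  by move/negP/negbTE.
rewrite S_indep; under eq_bigr do rewrite PE.
by rewrite prodEFin.
Qed.

Lemma has_mean_fast_links (f : {set 'I_N} -> R) :
  has_mean P (fun w => f (fast_links (S w)))
    (\sum_K subset_weight fast_prob K * f K).
Proof.
have -> : (fun w => f (fast_links (S w))) =
    (fun w => \sum_K f K * \1_[set w | fast_links (S w) = K] w).
  apply/funext => w; rewrite (bigD1 (fast_links (S w)))//= big1 => [|K neK].
    by rewrite addr0 indicE mem_set ?mulr1.
  rewrite indicE memNset ?mulr0// => /= E.
  by move: neK; rewrite E eqxx.
apply: has_mean_sum => K; rewrite mulrC -prob_fast_links.
by apply: has_meanZ; exact: (has_mean_event [set s | fast_links s = K]).
Qed.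

(** If every link reaches rate [m] with probability at least [p], thinning
    makes these probabilities equal to [p], and serving a uniformly chosen
    link among those left gives every link the same rate at least [m] times its
    chance of being chosen. *)
Lemma symmetric_rate_achievable (p : R) :
  0 <= p -> (forall i, p <= fast_prob i) ->
  symmetric_rates S (m%:R * (1 - (1 - p) ^+ N)).
Proof.
move=> p0 p_le.
have fast1 i : fast_prob i <= 1.
  rewrite /fast_prob -lee_fin fineK ?probability_le1//.
    exact: (measurable_event [set s | (m <= tnth s i)%N]).
  by rewrite fin_num_measure//;
    exact: (measurable_event [set s | (m <= tnth s i)%N]).
have fast0 i : 0 <= fast_prob i by exact: le_trans (p_le i).
pose t i := p / fast_prob i.
have t01 i : 0 <= t i <= 1.
  rewrite divr_ge0//=; have := fast0 i; rewrite le_eqVlt => /orP[/eqP fi|fi].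
    by rewrite /t -fi invr0 mulr0 ler01.
  by rewrite ler_pdivrMr// mul1r.
have fast_t i : fast_prob i * t i = p.
  have := fast0 i; rewrite le_eqVlt => /orP[/eqP fi|fi].
    by rewrite -fi mul0r; apply/eqP; rewrite eq_le p0 (le_trans (p_le i)) ?fi.
  by rewrite mulrC divfK// gt_eqF.
pose v (K : {set 'I_N}) j := if j \in K then t j else 0.
have v01 K j : 0 <= v K j <= 1 by rewrite /v; case: ifP; rewrite ?lexx ?ler01.
pose u s i := uniform_pick (v (fast_links s)) i.
have u0 s i : 0 <= u s i by exact: uniform_pick_ge0.
pose share (i : 'I_N) : R := uniform_pick (fun=> p) i.
have shareE (i : 'I_N) : share i = (1 - (1 - p) ^+ N) / N%:R.
  by rewrite /share uniform_pick_cst card_ord.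
have p1 (i : 'I_N) : p <= 1 by exact: le_trans (fast1 i).
have share0 i : 0 <= share i.
  by apply: uniform_pick_ge0 => j; rewrite p0 (p1 i).
have mean_u i : has_mean P (fun w => u (S w) i) (share i).
  have := has_mean_fast_links (fun K => uniform_pick (v K) i).
  rewrite uniform_pick_thin /share; congr (has_mean _ _ _).
  by rewrite /uniform_pick; apply: eq_bigr => J _; congr (_ * _);
    apply: eq_bigr => j _; rewrite fast_t.
pose g i (s : N.-tuple nat) := u s i * (tnth s i)%:R.
have int_g i : integrable_rv P (fun w => g i (S w)).
  apply: (@le_integrable_rv _ _ _ _ _ (fun w => (mu_max i)%:R * u (S w) i)).
  - apply: (determines_measurable_fun (g i)) => s.
    exact: (measurable_event [set s' | s' = s]).
  - move=> w; rewrite /g ger0_norm ?mulr_ge0// mulrC ler_wpM2r// ler_nat.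
    exact: S_le.
  - by apply: integrable_rvZ; case: (mean_u i).
pose r i := mean P (fun w => g i (S w)).
have r_ge i : m%:R * share i <= r i.
  apply: le_has_mean (has_meanZ m%:R (mean_u i)) (has_mean_mean (int_g i)) _ => w.
  rewrite /g mulrC; case: (boolP (i \in fast_links (S w))) => [|iN].
    by rewrite inE => mS; rewrite ler_wpM2l// ler_nat.
  by rewrite /u uniform_pick_eq0 ?mul0r// /v (negbTE iN).
(* the rate [r i] may exceed the target, so link [i] idles in proportion *)
pose c i := m%:R * share i / r i.
have target0 i : 0 <= m%:R * share i by rewrite mulr_ge0.
have r0 i : 0 <= r i by exact: le_trans (r_ge i).
have c0 i : 0 <= c i by rewrite divr_ge0.
have c1 i : c i <= 1.
  have := r0 i; rewrite le_eqVlt => /orP[/eqP ri|ri].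
    by rewrite /c -ri invr0 mulr0.
  by rewrite ler_pdivrMr// mul1r.
have c_r i : c i * r i = m%:R * share i.
  have := r0 i; rewrite le_eqVlt => /orP[/eqP ri|ri].
    have := r_ge i; rewrite -ri mulr0 => le0.
    by apply/eqP; rewrite eq_le target0 le0.
  by rewrite divfK// gt_eqF.
pose policy s (o : option 'I_N) :=
  if o is Some i then c i * u s i else 1 - \sum_i c i * u s i.
have sum_option (f : option 'I_N -> R) : \sum_o f o = f None + \sum_i f (Some i).
  rewrite (bigD1 None)//=; congr (_ + _).
  rewrite (reindex_omap Some id); first by apply: eq_big => // i; rewrite eqxx.
  by case.
split.
  move=> i; rewrite mxE -mulrA -(shareE i); exact: target0.
exists policy.
  move=> s; split; last by rewrite sum_option /policy subrK.
  case=> [i|] /=; first by rewrite mulr_ge0.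
  rewrite subr_ge0 (@le_trans _ _ (\sum_i u s i))//.
    by apply: ler_sum => i _; rewrite ler_piMl.
  rewrite sum_uniform_pick gerBl prodr_ge0// => j _.
  by rewrite subr_ge0; case/andP: (v01 (fast_links s) j).
move=> i; rewrite mxE -mulrA -(shareE i) -c_r.
have serviceE s : policy_service policy s i = c i * g i s.
  rewrite /policy_service sum_option /= /served /= mulr0 add0r.
  rewrite (bigD1 i)//= big1 ?addr0 => [|j ji].
    by rewrite eqxx -mulrA.
  by rewrite (inj_eq Some_inj) (negbTE ji) mulr0.
rewrite /policy_rate -/(policy_service policy _ i).
have [intc <-] := has_meanZ (c i) (has_mean_mean (int_g i)).
rewrite -(expectation_mean intc); congr ('E_P[_])%E.
by apply/funext => w; rewrite -serviceE.
Qed.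

End SymmetricRate.

(** * Stability and delay of max-weight *)

Unset Implicit Arguments.
Set Strict Implicit.
Set Printing Implicit Defensive.

Theorem lemma10 (R : realType) (d : measure_display) (Omega : measurableType d)
    (P : probability Omega R) (N : nat)
    (mu_max : 'I_N -> nat) (lambda : 'rV[R]_N) (rho : R)
    (A S Q : nat -> {RV P >-> N.-tuple nat})
    (d' : measure_display) (T' : measurableType d') (U : {RV P >-> T'})
    (sel : nat -> Omega -> option 'I_N)
    (* channels *)
    (mu_max_gt0 : forall i, (0 < mu_max i)%N)
    (S_le : forall t w i, (tnth (S t w) i <= mu_max i)%N)
    (S_iid : iid S)
    (* arrivals *)
    (A_iid : iid A)
    (A_mean : forall t i, ('E_P[fun w => (tnth (A t w) i)%:R] = (lambda 0 i)%:E)%E)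
    (A_sq : forall t i, ('E_P[fun w => ((tnth (A t w) i)%:R ^+ 2)%R] < +oo)%E)
    (lambda_tot_gt0 : 0 < \sum_(i < N) lambda 0 i)
    (* initial backlogs and independence *)
    (Q0_sq : forall i, ('E_P[fun w => ((tnth (Q 0%N w) i)%:R ^+ 2)%R] < +oo)%E)
    (A_S_indep : independent P (process_sigma A) (process_sigma S))
    (Q0_U_indep : independent P
       <<s g_sigma_algebra_preimage (Q 0%N) `|` g_sigma_algebra_preimage U >>
       <<s process_sigma A `|` process_sigma S >>)
    (* queue dynamics under the max-weight algorithm *)
    (Q_step : forall t w,
       Q t.+1 w = backlog_step (Q t w) (S t w) (A t w) (sel t w))
    (sel_max_weight : forall t w, max_weight_choice (Q t w) (S t w) (sel t w))
    (sel_nonanticipating : nonanticipating (Q 0%N) U A S sel)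
    (* load *)
    (rho_gt0 : 0 < rho) (rho_lt1 : rho < 1)
    (lambda_in : [set rho *: x | x in capacity_region (S 0%N)] lambda) :
  let lambda_tot := \sum_(i < N) lambda 0 i in
  stable Q /\
  forall mu_sym : R, is_largest (symmetric_rates (S 0%N)) mu_sym ->
  (0 < mu_sym ->
   (forall i, cvgn (time_average Q i)) ->
   (average_delay lambda_tot Q <=
     (N%:R * ((2 * lambda_tot)^-1 * (\sum_(i < N) second_moment (A 0%N) i)
              - 3 / (2 * lambda_tot) * (\sum_(i < N) lambda 0 i ^+ 2))
        / ((1 - rho) * mu_sym)
      + N%:R * Num.min (\sum_(i < N) lambda 0 i * (mu_max i)%:R / lambda_tot)
                       (max_rate_second_moment (S 0%N) / lambda_tot)
        / ((1 - rho) * mu_sym))%:E)%E) /\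
  (mutually_independent P
     (fun i : 'I_N => process_sigma (fun t w => tnth (S t w) i)) ->
   (forall t i, (0 < P [set w | tnth (S t w) i = mu_max i])%E) ->
   (min_rate mu_max)%:R * (1 - (1 - min_prob (S 0%N) (min_rate mu_max)) ^+ N)
     <= mu_sym).
Proof.
move=> lambda_tot.
case: lambda_in => x x_cap; move/esym => lambda_x.
split.
  exact: (max_weight_stable S_le S_iid A_iid A_mean A_sq Q0_sq A_S_indep
    Q0_U_indep Q_step sel_max_weight sel_nonanticipating rho_gt0 rho_lt1 x_cap
    lambda_x).
move=> mu_sym [mu_cap mu_largest]; split=> [mu_gt0 cvgQ|S_links _].
- have delay := max_weight_delay S_le S_iid A_iid A_mean A_sq Q0_sq A_S_indep
    Q0_U_indep Q_step sel_max_weight sel_nonanticipating rho_gt0 rho_lt1 x_cap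
    lambda_x mu_gt0 mu_cap cvgQ.
  have ltot_ge0 : 0 <= lambda_tot^-1 by rewrite invr_ge0 ltW.
  have tot0 : lambda_tot != 0 by rewrite gt_eqF.
  apply: (@le_trans _ _ ((lambda_tot^-1)%:E * _)%E).
    by apply: lee_wpmul2l delay; rewrite lee_fin.
  rewrite -EFinM lee_fin -mulr_suml -minr_pMl// /drift_bound.
  set a := \sum_(i < N) second_moment _ _; set b := \sum_(i < N) _ ^+ 2.
  set e := Num.min _ _; rewrite le_eqVlt; apply/orP; left; apply/eqP.
  by field; rewrite tot0 !gt_eqF// subr_gt0.
- apply: mu_largest; apply: (symmetric_rate_achievable (S_le 0%N)) => [E||i].
  + pose F i := [set w | E i (tnth (S 0%N w) i)].
    have := S_links (index_enum 'I_N) F (index_enum_uniq _).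
    rewrite (_ : [set` index_enum 'I_N] = setT); last first.
      by apply/seteqP; split => // i _; exact: mem_index_enum.
    apply => i _; apply: sub_sigma_algebra; exists 0%N => //.
    by exists (E i) => //; rewrite setTI.
  + by apply: le_bigmin => // i _; exact: fine_ge0.
  + exact: bigmin_le.
Qed.
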